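(* Suppose $M-2\notin-2\mathbb N$ and define the superfunction $$\mathbb K(z,w):=\Gamma\!\left(\tfrac M2-1\right)\widetilde I_{\frac M2-2}\big(\sqrt{(z|\overline w)}\big)=\sum_{k=0}^\infty\frac{1}{4^kk!}\left(\tfrac M2-1\right)_k^{-1}(z|\overline w)^k .$$ Then for all $p\in\mathcal F=\mathcal P(\mathbb C^{m|2n})/\langle R^2\rangle$ we have $$\langle p,\mathbb K(z,w)\rangle_{\mathcal B}=p(w)$$ (as elements of the polynomial Fock space in the variables $w$, i.e. modulo $\langle R_w^2\rangle$).
   Context: $\mathbb N=\{0,1,2,\dots\}$. Fix integers $m\ge 2$, $n\ge 0$ and put $M=m-2n$. Set $|i|=0$ for $0\le i\le m-1$ and $|i|=1$ for $m\le i\le m+2n-1$. $\mathcal P(\mathbb C^{m|2n})=\mathbb C[z_0,\dots,z_{m-1}]\otimes\Lambda(z_m,\dots,z_{m+2n-1})$ is the superalgebra of complex superpolynomials, with $z_iz_j=(-1)^{|i||j|}z_jz_i$. $\beta=(\beta_{ij})_{i,j=0}^{m+2n-1}$ is the matrix with $\beta_{00}=-1$, $\beta_{ii}=1$ for $1\le i\le m-1$, $\beta_{m+i,m+n+i}=-1$ and $\beta_{m+n+i,m+i}=1$ for $0\le i<n$, all other entries $0$; $(\beta^{ij})$ is its inverse matrix. $\partial^i$ is the (left) superderivation of parity $|i|$ with $\partial^i(z_j)=\delta_{ij}$, and $\partial_j=\sum_i\beta_{ji}\partial^i$. Put $R^2=\sum_{i,j}\beta^{ij}z_iz_j$ (written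 $R_w^2$ in variables $w$), $\mathbb E=\sum_{i,j}\beta^{ij}z_i\partial_j$, $\Delta=\sum_{i,j}\beta^{ij}\partial_i\partial_j$; $\langle R^2\rangle$ is the ideal generated by $R^2$. The polynomial Fock space is $\mathcal F=\mathcal P(\mathbb C^{m|2n})/\langle R^2\rangle$. Bessel operators: $\mathcal B(z_k)=(M-2+2\mathbb E)\partial_k-z_k\Delta$; modified: $\widetilde{\mathcal B}(z_0)=-\mathcal B(z_0)$, $\widetilde{\mathcal B}(z_k)=\mathcal B(z_k)$ for $k\ge1$. They supercommute and preserve $\langle R^2\rangle$. The Bessel--Fischer product is $\langle p,q\rangle_{\mathcal B}=p(\widetilde{\mathcal B})\,\bar q(z)|_{z=0}$, where $p(\widetilde{\mathcal B})$ replaces each $z_i$ by $\widetilde{\mathcal B}(z_i)$ (keeping the order of factors) and $\bar q$ is $q$ with complex conjugated coefficients; it descends to $\mathcal F$, and components of different degree are orthogonal. $w_0,\dots,w_{m+2n-1}$ is a second set of variables of the same parities, supercommuting with the $z$'s, acting as parameters (the Bessel--Fischer product is taken in $z$); $\overline w_j$ is the conjugate variable, and the conjugation $q\mapsto\bar q$ in the Bessel--Fischer product turns $\overline w_j$ into $w_j$. For two such sets, $z|w:=2z_0w_0+2\sum_{i,j=1}^{m+2n-1}z_i\beta^{ij}w_j$. The product with the series $\mathbb K(z,w)$ is taken term by term (only finitely many terms contribute for a given polynomial). $(a)_k=a(a+1)\cdots(a+k-1)$ is the Pochhammer symbol and $\widetilde I_\alpha(t)=(t/2)^{-\alpha}I_\alpha(t)=\sum_{k\ge0}\frac{1}{k!\,\Gamma(k+\alpha+1)}(t/2)^{2k}$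 is the renormalised I-Bessel function. *)

(* Defs.v *)
From HB Require Import structures.
From mathcomp Require Import all_boot all_order all_algebra.
From mathcomp Require Import complex boolp reals mpoly.
From mathcomp Require classical_sets sequences measure exp.
From mathcomp Require lebesgue_measure lebesgue_integral.

Set Implicit Arguments.
Unset Strict Implicit.
Unset Printing Implicit Defensive.

Import Order.TTheory GRing.Theory Num.Theory.
Local Open Scope ring_scope.
Local Open Scope quotient_scope.

(* The notations of mathcomp-analysis and of multinomials are incompatible,   *)
(* hence the analysis files are only imported inside this module.             *)
Module EulerGamma.
Import classical_sets sequences measure exp lebesgue_measure lebesgue_integral.

Definition gamma_int (R : realType) (x : R) : R :=
  \int[lebesgue_measure]_(t in [set` `]0, +oo[]) (powR t (x - 1) * expR (- t)).

End EulerGamma.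

Definition poch (R : pzRingType) (a : R) (k : nat) : R :=
  \prod_(i < k) (a + i%:R).

(* Euler's integral for x > 0, continued to x <= 0 by                         *)
(* Gamma x = Gamma (x + k) / (x)_k, where k is least with x + k > 0; the      *)
(* value at the poles 0, -1, -2, ... is 0.                                    *)
Definition Gamma (R : realType) (x : R) : R :=
  let k := if 0 < x then 0%N else (Num.truncn (- x)).+1 in
  EulerGamma.gamma_int (x + k%:R) / poch x k.

(* superpoly K a b is K[x_0, ..., x_(a-1)] (x) Lambda(t_0, ..., t_(b-1)): an  *)
(* element f stands for the sum over D of f D * t_D, where                    *)
(* t_D = t_(d1) t_(d2) ... with d1 < d2 < ... the elements of D.              *)
Definition superpoly (K : comNzRingType) (a b : nat) : Type :=
  {ffun {set 'I_b} -> {mpoly K[a]}}.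

HB.instance Definition _ (K : comNzRingType) (a b : nat) :=
  GRing.Lmodule.copy (superpoly K a b) {ffun {set 'I_b} -> {mpoly K[a]}}.

Definition spcoef (K : comNzRingType) (a b : nat) (f : superpoly K a b)
  (D : {set 'I_b}) : {mpoly K[a]} := (f : {ffun _ -> _}) D.

Definition mkspoly (K : comNzRingType) (a b : nat)
  (F : {set 'I_b} -> {mpoly K[a]}) : superpoly K a b := [ffun D => F D].

(* t_A t_B = (-1)^(inversions A B) t_(A :|: B) for disjoint A and B.          *)
Definition inversions (b : nat) (A B : {set 'I_b}) : nat :=
  \sum_(i in A) \sum_(j in B) (j < i)%N.

Section SuperAlgebra.
Variables (K : comNzRingType) (a b : nat).
Local Notation SP := (superpoly K a b).
Implicit Types (f g h : SP) (A B C D : {set 'I_b}).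

Lemma spcoefE F D : spcoef (mkspoly F : SP) D = F D.
Proof. by rewrite /spcoef ffunE. Qed.

Lemma spolyP f g : (forall D, spcoef f D = spcoef g D) <-> f = g.
Proof. by split=> [e|-> //]; apply/ffunP. Qed.

Lemma spcoefD f g D : spcoef (f + g) D = spcoef f D + spcoef g D.
Proof. by rewrite /spcoef ffunE. Qed.

Lemma spcoef0 D : spcoef (0 : SP) D = 0.
Proof. by rewrite /spcoef ffunE. Qed.

Lemma spcoefZ (c : K) f D : spcoef (c *: f) D = c *: spcoef f D.
Proof. by rewrite /spcoef ffunE. Qed.

Definition sp_one : SP := mkspoly (fun D => (D == set0)%:R).

Definition sp_mul f g : SP := mkspoly (fun D =>
  \sum_(A : {set 'I_b} | A \subset D)
     (-1) ^+ inversions A (D :\: A) * spcoef f A * spcoef g (D :\: A)).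

Lemma inversions0l A : inversions set0 A = 0%N.
Proof. by rewrite /inversions big_set0. Qed.

Lemma inversions0r A : inversions A set0 = 0%N.
Proof. by rewrite /inversions big1 // => i _; rewrite big_set0. Qed.

Lemma inversionsUl A B C : [disjoint A & B] ->
  inversions (A :|: B) C = (inversions A C + inversions B C)%N.
Proof.
move=> dAB; rewrite /inversions -bigU //=.
by apply: eq_bigl => i; rewrite !inE.
Qed.

Lemma inversionsUr A B C : [disjoint B & C] ->
  inversions A (B :|: C) = (inversions A B + inversions A C)%N.
Proof.
move=> dBC; rewrite /inversions -big_split /=; apply: eq_bigr => i _.
by rewrite -bigU //=; apply: eq_bigl => j; rewrite !inE.
Qed.

Lemma sp_mul1l : left_id sp_one sp_mul.
Proof.
move=> f; apply/spolyP => D; rewrite spcoefE (bigD1 set0) ?sub0set //=.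
rewrite setD0 inversions0l expr0 mul1r spcoefE eqxx mul1r big1 ?addr0 // => A.
by case/andP=> _ /negbTE nA; rewrite spcoefE nA mulr0 mul0r.
Qed.

Lemma sp_mul1r : right_id sp_one sp_mul.
Proof.
move=> f; apply/spolyP => D; rewrite spcoefE (bigD1 D) //=.
rewrite setDv inversions0r expr0 mul1r spcoefE eqxx mulr1 big1 ?addr0 // => A.
case/andP=> sAD nA; rewrite spcoefE setD_eq0.
suff /negbTE-> : ~~ (D \subset A) by rewrite mulr0.
by apply: contra nA => sDA; rewrite eqEsubset sAD.
Qed.

Lemma sp_mulDl : left_distributive sp_mul +%R.
Proof.
move=> f g h; apply/spolyP => D; rewrite spcoefD !spcoefE -big_split /=.
by apply: eq_bigr => A _; rewrite spcoefD mulrDr mulrDl.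
Qed.

Lemma sp_mulDr : right_distributive sp_mul +%R.
Proof.
move=> f g h; apply/spolyP => D; rewrite spcoefD !spcoefE -big_split /=.
by apply: eq_bigr => A _; rewrite spcoefD mulrDr.
Qed.

Lemma sp_mulA : associative sp_mul.
Proof.
move=> f g h; apply/esym/spolyP => D; rewrite !spcoefE.
under eq_bigr => E _ do rewrite spcoefE mulr_sumr mulr_suml.
rewrite (exchange_big_dep (fun A : {set 'I_b} => A \subset D)) /=; last first.
  by move=> E A sED sAE; apply: subset_trans sED.
apply: eq_bigr => A sAD; rewrite spcoefE mulr_sumr.
rewrite (reindex_onto (fun B => A :|: B) (fun E => E :\: A)) /=; last first.
  move=> E /andP[_ sAE]; apply/setP => x; rewrite !inE.
  by case: (boolP (x \in A)) => //= /(subsetP sAE).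
apply: eq_big => [B|B /andP[/andP[sD _] /eqP eB]].
  rewrite subUset sAD subsetUl andbT subsetD; congr (_ && _).
  by rewrite setDUl setDv set0U; exact: (sameP eqP setDidPl).
have dAB : [disjoint A & B].
  by rewrite -eB -setI_eq0 setIDA setDIl setDv set0I.
have -> : D :\: (A :|: B) = D :\: A :\: B by rewrite setDDl.
rewrite eB; set C := D :\: A :\: B.
have -> : D :\: A = B :|: C.
  rewrite /C; apply/setP => x; rewrite !inE.
  move: sD; rewrite subUset => /andP[_ /subsetP sBD].
  case: (boolP (x \in B)) => //= xB; rewrite (sBD _ xB) andbT.
  by apply/negP => xA; move: dAB; rewrite disjoint_sym => /disjointFr/(_ xB); rewrite xA.
have dBC : [disjoint B & C].
  by rewrite disjoint_sym disjoints_subset /C setDE subsetIr.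
rewrite inversionsUl // inversionsUr // !exprD.
rewrite !mulrA; congr (_ * _); congr (_ * _).
by rewrite [RHS]mulrAC; congr (_ * _); rewrite mulrC mulrA.
Qed.

Lemma sp_one_neq0 : sp_one != 0.
Proof.
apply/eqP => /spolyP/(_ set0); rewrite spcoef0 spcoefE eqxx => /eqP.
by rewrite oner_eq0.
Qed.

HB.instance Definition _ := GRing.Zmodule_isNzRing.Build (superpoly K a b)
  sp_mulA sp_mul1l sp_mul1r sp_mulDl sp_mulDr sp_one_neq0.

Lemma spcoefM f g D : spcoef (f * g) D =
  \sum_(A : {set 'I_b} | A \subset D)
     (-1) ^+ inversions A (D :\: A) * spcoef f A * spcoef g (D :\: A).
Proof. exact: spcoefE. Qed.

Lemma spcoef1 D : spcoef (1 : SP) D = (D == set0)%:R.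
Proof. exact: spcoefE. Qed.

Lemma sp_scaleAl (c : K) f g : c *: (f * g) = (c *: f) * g.
Proof.
apply/spolyP => D; rewrite spcoefZ !spcoefM scaler_sumr.
by apply: eq_bigr => A _; rewrite spcoefZ -scalerAr -scalerAl.
Qed.

HB.instance Definition _ :=
  GRing.Lmodule_isLalgebra.Build K (superpoly K a b) sp_scaleAl.

Lemma sp_scaleAr (c : K) f g : c *: (f * g) = f * (c *: g).
Proof.
apply/spolyP => D; rewrite spcoefZ !spcoefM scaler_sumr.
by apply: eq_bigr => A _; rewrite spcoefZ -scalerAr.
Qed.

HB.instance Definition _ :=
  GRing.Lalgebra_isAlgebra.Build K (superpoly K a b) sp_scaleAr.

Definition evar (i : 'I_a) : SP :=
  mkspoly (fun D => if D == set0 then 'X_i else 0).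

Definition ovar (j : 'I_b) : SP := mkspoly (fun D => (D == [set j])%:R).

Definition ederiv (i : 'I_a) f : SP := mkspoly (fun D => mderiv i (spcoef f D)).

(* t_j t_D = (-1)^(inversions [set j] D) t_(j |: D) for j \notin D, and the   *)
(* left derivative removes t_j from the front.                                *)
Definition oderiv (j : 'I_b) f : SP := mkspoly (fun D =>
  if j \in D then 0
  else (-1) ^+ inversions [set j] D * spcoef f (j |: D)).

Lemma spcoef_evarM i f D : spcoef (evar i * f) D = 'X_i * spcoef f D.
Proof.
rewrite spcoefM (bigD1 set0) ?sub0set //= big1 ?addr0 => [|A].
  by rewrite inversions0l expr0 mul1r setD0 spcoefE eqxx.
by case/andP=> _ /negbTE nA; rewrite spcoefE nA mulr0 mul0r.
Qed.

Lemma spcoef_ovarM j f D : spcoef (ovar j * f) D =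
  if j \in D then (-1) ^+ inversions [set j] (D :\ j) * spcoef f (D :\ j) else 0.
Proof.
rewrite spcoefM; case: ifPn => jD; last first.
  apply: big1 => A sAD; rewrite spcoefE; case: eqP => [eA|]; last first.
    by rewrite mulr0 mul0r.
  by move: sAD jD; rewrite eA sub1set => ->.
rewrite (bigD1 [set j]) ?sub1set //= big1 ?addr0 => [|A].
  by rewrite spcoefE eqxx mulr1.
by case/andP=> _ /negbTE nA; rewrite spcoefE nA mulr0 mul0r.
Qed.

Lemma evar_central i f : evar i * f = f * evar i.
Proof.
apply/spolyP => D; rewrite spcoef_evarM spcoefM (bigD1 D) //= big1.
  by rewrite addr0 setDv inversions0r expr0 mul1r spcoefE eqxx mulrC.
move=> A /andP[sAD nA]; rewrite spcoefE setD_eq0.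
suff /negbTE-> : ~~ (D \subset A) by rewrite mulr0.
by apply: contra nA => sDA; rewrite eqEsubset sAD.
Qed.

Lemma inversions1U j k D : k \notin D ->
  inversions [set j] (k |: D) = ((k < j) + inversions [set j] D)%N.
Proof. by move=> kD; rewrite /inversions !big_set1 big_setU1. Qed.

Lemma inversions1D j k D : k \in D ->
  inversions [set j] D = ((k < j) + inversions [set j] (D :\ k))%N.
Proof. by move=> kD; rewrite -[in LHS](setD1K kD) inversions1U // !inE eqxx. Qed.

Lemma ovar_sqr j f : ovar j * (ovar j * f) = 0.
Proof.
apply/spolyP => D; rewrite spcoef_ovarM spcoef0; case: ifP => // _.
by rewrite spcoef_ovarM !inE eqxx mulr0.
Qed.

Lemma ovar_anticomm j k : ovar j * ovar k = - (ovar k * ovar j).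
Proof.
have anti (f : SP) : j != k -> ovar j * (ovar k * f) = - (ovar k * (ovar j * f)).
  move=> njk; apply/spolyP => D.
  have -> u : spcoef (- u : SP) D = - spcoef u D by rewrite /spcoef ffunE.
  rewrite !spcoef_ovarM !inE (eq_sym k) njk /=.
  case: (boolP (j \in D)) => jD; case: (boolP (k \in D)) => kD;
    rewrite ?mulr0 ?oppr0 //.
  have jDk : j \in D :\ k by rewrite !inE njk.
  have kDj : k \in D :\ j by rewrite !inE eq_sym njk.
  rewrite (inversions1D j kDj) (inversions1D k jDk).
  have -> : D :\ k :\ j = D :\ j :\ k.
    by apply/setP => x; rewrite !inE andbCA.
  have : (k < j)%N = ~~ (j < k)%N.
    by move: njk; rewrite -(inj_eq val_inj) /=; case: ltngtP.
  move=> ->; case: ltnP => _ /=; rewrite add0n add1n exprS mulN1r.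
    by rewrite mulNr opprK mulrCA.
  by rewrite mulNr mulrCA.
have [->|njk] := eqVneq j k.
  by have := ovar_sqr k 1; rewrite mulr1 => ->; rewrite oppr0.
by have := anti 1 njk; rewrite !mulr1.
Qed.

Lemma ederiv_evarM i k f :
  ederiv i (evar k * f) = (i == k)%:R *: f + evar k * ederiv i f.
Proof.
apply/spolyP => D; rewrite spcoefE spcoefD spcoefZ !spcoef_evarM spcoefE.
rewrite mderivM mderivX mnm1E (eq_sym k); congr (_ + _).
have [->|_] := eqVneq i k; last by rewrite !scale0r mul0r.
have -> : (U_(k) - U_(k))%MM = 0%MM :> 'X_{1..a}.
  by apply/mnmP => l; rewrite mnmBE mnm0E subnn.
by rewrite mpolyX0 !scale1r mul1r.
Qed.

Lemma ederiv_ovarM i j f : ederiv i (ovar j * f) = ovar j * ederiv i f.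
Proof.
apply/spolyP => D; rewrite spcoefE !spcoef_ovarM.
case: ifP => _; last by rewrite linear0.
rewrite spcoefE -signr_odd; case: (odd _); rewrite ?expr0 ?expr1 ?mul1r //.
by rewrite !mulN1r linearN.
Qed.

Lemma oderiv_evarM j i f : oderiv j (evar i * f) = evar i * oderiv j f.
Proof.
apply/spolyP => D; rewrite spcoefE !spcoef_evarM spcoefE.
by case: ifP => _; rewrite ?mulr0 // mulrCA.
Qed.

Lemma oderiv_ovarM j k f :
  oderiv j (ovar k * f) = (j == k)%:R *: f - ovar k * oderiv j f.
Proof.
have spN u D : spcoef (- u : SP) D = - spcoef u D by rewrite /spcoef ffunE.
apply/spolyP => D; rewrite spcoefE spcoefD spN spcoefZ !spcoef_ovarM !spcoefE.
have [<-|njk] := eqVneq j k.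
  rewrite !inE eqxx /=; case: (boolP (j \in D)) => jD.
    by rewrite setD1K // mulrA -expr2 sqrr_sign mul1r scale1r subrr.
  by rewrite setU1K // mulrA -expr2 sqrr_sign mul1r scale1r oppr0 addr0.
rewrite !inE (negbTE njk) eq_sym (negbTE njk) /= scale0r add0r.
case: (boolP (j \in D)) => jD; first by rewrite mulr0 if_same oppr0.
case: ifP => kD; last by rewrite mulr0 oppr0.
have -> : (j |: D) :\ k = j |: D :\ k.
  by apply/setP => x; rewrite !inE; case: eqP => // ->; rewrite eq_sym (negbTE njk).
have jDk : j \notin D :\ k by rewrite !inE (negbTE jD) andbF.
rewrite (inversions1D j kD) (inversions1U k jDk).
have : (k < j)%N = ~~ (j < k)%N.
  by move: njk; rewrite -(inj_eq val_inj) /=; case: ltngtP.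
move=> ->; case: ltnP => _ /=; rewrite add0n add1n exprS mulN1r.
  by rewrite mulNr mulrN mulrCA.
by rewrite mulNr mulrCA.
Qed.

End SuperAlgebra.

(* The ideal generated by r.                                                  *)
Definition ideal_gen (A : nzRingType) (r : A) : {pred A} := fun x =>
  `[< exists s : seq (A * A), x = \sum_(u <- s) u.1 * r * u.2 >].

Lemma ideal_gen_zmod_closed (A : nzRingType) (r : A) :
  zmod_closed (ideal_gen r).
Proof.
split=> [|x y /asboolP[s ->] /asboolP[t ->]]; apply/asboolP.
  by exists [::]; rewrite big_nil.
exists (s ++ [seq (- u.1, u.2) | u <- t]).
rewrite big_cat big_map /= -sumrN; congr (_ + _).
by apply: eq_bigr => u _; rewrite !mulNr.
Qed.

HB.instance Definition _ (A : nzRingType) (r : A) :=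
  GRing.isZmodClosed.Build A (ideal_gen r) (ideal_gen_zmod_closed r).

(* s is the sum of the series u, all but finitely many terms of which vanish. *)
Definition has_finsum (V : zmodType) (u : nat -> V) (s : V) : Prop :=
  exists N : nat, (forall k, (N <= k)%N -> u k = 0) /\ s = \sum_(k < N) u k.

(* P(C^(a|b)) is superpoly K a b with variables indexed by 'I_(a + b), the    *)
(* even ones first. Superpolynomials in z and w are the elements of           *)
(* superpoly K (a + a) (b + b), the left summands indexing the z's.           *)
Section ZWVariables.
Variables (K : comNzRingType) (a b : nat).
Implicit Type k : 'I_(a + b).

Definition spvar k : superpoly K a b :=
  match split k with inl i => evar K b i | inr j => ovar K a j end.

Definition zvar k : superpoly K (a + a) (b + b) :=
  match split k with
  | inl i => evar K (b + b) (lshift a i)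
  | inr j => ovar K (a + a) (lshift b j)
  end.

Definition wvar k : superpoly K (a + a) (b + b) :=
  match split k with
  | inl i => evar K (b + b) (rshift a i)
  | inr j => ovar K (a + a) (rshift b j)
  end.

Definition zderiv k (f : superpoly K (a + a) (b + b)) :
    superpoly K (a + a) (b + b) :=
  match split k with
  | inl i => ederiv (lshift a i) f
  | inr j => oderiv (lshift b j) f
  end.

(* Evaluation at z = 0, with values in the superpolynomials in w.             *)
Definition at_z0 (f : superpoly K (a + a) (b + b)) : superpoly K a b :=
  mkspoly (fun D =>
    spcoef f [set rshift b j | j in D] \mPo
      [tuple match split i with inl _ => 0 | inr j => 'X_j end | i < a + a]).

(* The factors, in order, of the monomial x^mu * t_D.                         *)
Definition factors (mu : 'X_{1..a}) (D : {set 'I_b}) : seq 'I_(a + b) :=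
  flatten [seq nseq (mu i) (lshift b i) | i <- enum 'I_a]
  ++ [seq rshift a j | j <- enum D].

(* p(T), where T k is substituted for the k-th variable of p.                 *)
Definition subst_op (V : lmodType K) (T : 'I_(a + b) -> V -> V)
    (p : superpoly K a b) (v : V) : V :=
  \sum_(D : {set 'I_b}) \sum_(mu <- msupp (spcoef p D))
     (spcoef p D)@_mu *: foldr T v (factors mu D).

End ZWVariables.

Definition superdim (m n : nat) : int := m%:Z - (2 * n)%:Z.

Section Fock.
Variables (R : realType) (m n : nat).
Local Notation C := R[i].
Local Notation I := 'I_(m + 2 * n).
Local Notation Pz := (superpoly C m (2 * n)).
Local Notation Pzw := (superpoly C (m + m) (2 * n + 2 * n)).
Local Notation z := (@zvar C m (2 * n)).
Local Notation w := (@wvar C m (2 * n)).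
Implicit Types (k : I) (f : Pzw).

Definition beta : 'M[C]_(m + 2 * n) := \matrix_(i, j)
  if [&& val i == 0 & val j == 0]%N then -1
  else if [&& (0 < i)%N, (i < m)%N & i == j] then 1
  else if [&& m <= i, i < m + n & val j == i + n]%N then -1
  else if [&& m <= j, j < m + n & val i == j + n]%N then 1
  else 0.

Local Notation beta_inv := (invmx beta).

Definition R2 : Pz :=
  \sum_(i : I) \sum_(j : I) beta_inv i j *: (spvar C i * spvar C j).

Definition fock : zmodType := {ideal_quot (ideal_gen R2)}.

(* \partial_k; the derivations \partial^k are zderiv k.                       *)
Definition zpartial k f : Pzw := \sum_(i : I) beta k i *: zderiv i f.

Definition euler f : Pzw :=
  \sum_(i : I) \sum_(j : I) beta_inv i j *: (z i * zpartial j f).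

Definition laplace f : Pzw :=
  \sum_(i : I) \sum_(j : I) beta_inv i j *: zpartial i (zpartial j f).

Definition bessel k f : Pzw :=
  (superdim m n - 2)%:~R *: zpartial k f + 2%:R *: euler (zpartial k f)
  - z k * laplace f.

Definition bessel_mod k f : Pzw :=
  if (val k == 0)%N then - bessel k f else bessel k f.

(* Complex conjugation of superpolynomials in z and the conjugate variables   *)
(* of w: the second block of variables stands for the conjugates of the w's   *)
(* in the argument and for the w's themselves in the result.                  *)
Definition conj_sp f : Pzw := mkspoly (fun D => map_mpoly conjc (spcoef f D)).

(* The Bessel-Fischer product, where q is a superpolynomial in z and the      *)
(* conjugates of the w's; the value is a superpolynomial in w.                *)
Definition bessel_fischer (p : Pz) (q : Pzw) : Pz :=
  at_z0 (subst_op bessel_mod p (conj_sp q)).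

Definition zw : Pzw :=
  \sum_(i : I | val i == 0%N) 2%:R *: (z i * w i)
  + 2%:R *: \sum_(i : I | val i != 0%N) \sum_(j : I | val j != 0%N)
      beta_inv i j *: (z i * w j).

(* Coefficient of t^(2k) in the renormalised I-Bessel function of index al.   *)
Definition besselI_coef (al : R) (k : nat) : R :=
  (k`!%:R * Gamma (k%:R + al + 1))^-1 * (1 / 2) ^+ (2 * k).

(* Terms of the series of the renormalised I-Bessel function at sqrt X.       *)
Definition besselI_sqrt (al : R) (X : Pzw) (k : nat) : Pzw :=
  real_complex R (besselI_coef al k) *: X ^+ k.

Definition half_superdim : R := (superdim m n)%:~R / 2.

(* The terms of K(z, w); its second block of variables stands for the         *)
(* conjugates of the w's.                                                     *)
Definition rep_kernel (k : nat) : Pzw :=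
  real_complex R (Gamma (half_superdim - 1))
    *: besselI_sqrt (half_superdim - 2) zw k.

End Fock.

(* Main.v *)
Require Import Defs.
From HB Require Import structures.
From mathcomp Require Import all_boot all_order all_algebra.
From mathcomp Require Import complex boolp reals mpoly.
From mathcomp Require Import ring lra zify.
From mathcomp Require classical_sets functions ereal topology normedtype.
From mathcomp Require sequences derive realfun measure exp lebesgue_measure.
From mathcomp Require numfun measurable_realfun lebesgue_integral ftc.

Set Implicit Arguments.
Unset Strict Implicit.
Unset Printing Implicit Defensive.

Import Order.TTheory GRing.Theory Num.Theory.
Local Open Scope ring_scope.
Local Open Scope quotient_scope.

(* Write X for z|w and a for M/2 - 1.  A direct computation gives
     B(z_k) X^(d+1) = 4 (d+1) (a+d) (+-w_k) X^d - z_k Delta(X^(d+1)),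
   where Delta(X^(d+1)) is a multiple of R_w^2.  Hence the degree d part K_d of
   the kernel satisfies B~(z_k) K_(d+1) = w_k K_d modulo R_w^2, and as B~(z_k)
   supercommutes with the variables w, a monomial p of degree d sends K_d to
   p(w) K_0 = p(w).  For e < d the operator p(B~) kills K_e modulo R_w^2, and
   for e > d the result still has positive degree in z, so it vanishes at
   z = 0.  The two expressions for K agree because Gamma(x + 1) = x Gamma(x). *)

(** * The functional equation of the Gamma function *)

(** Two kinds of control over the operators are needed. Congruences modulo R_w^2 give the value of
    the sum but leave an unknown remainder at z = 0, whereas the terms of the series must vanish
    exactly from some degree on. Exact vanishing comes from the filtration by powers of the ideal of
    the z's, which each B~(z_k) lowers by at most one. Signs are tracked only against the w's: an
    operator has a parity if it passes each w_j with the Koszul sign. The z's enter through the even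
    element X, and in the computations these signs occur in pairs and cancel. The sign in B~(z_0)
    compensates that X contains +2 z_0 w_0 while beta^00 = -1. The assumption on M says that a + l
    is nonzero for every natural l, so that (a)_d does not vanish and a is not a pole of Gamma. As
    Gamma is an improper integral, its functional equation is obtained in the extended reals from
    compact intervals, before convergence is known, and convergence is deduced from it. *)

Module GammaTheory.
Import classical_sets functions ereal topology normedtype sequences derive.
Import realfun measure exp lebesgue_measure numfun measurable_realfun.
Import lebesgue_integral ftc.
Import numFieldNormedType.Exports.
Local Open Scope classical_set_scope.
Local Open Scope ring_scope.

Section Gamma.
Variable R : realType.
Implicit Types (x t : R) (n : nat).
Local Notation mu := (@lebesgue_measure R).

Definition gamma_fun x t := t `^ (x - 1) * expR (- t).

Definition egamma x : \bar R :=
  (\int[mu]_(t in [set` `]0%R, +oo[]) (gamma_fun x t)%:E)%E.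

Lemma gamma_intE x : EulerGamma.gamma_int x = fine (egamma x).
Proof. by []. Qed.

Lemma gamma_fun_ge0 x t : 0 <= gamma_fun x t.
Proof. by rewrite mulr_ge0 ?powR_ge0 ?expR_ge0. Qed.

Lemma measurable_gamma_fun x D : measurable_fun D (gamma_fun x).
Proof.
apply: measurable_funTS; apply: measurable_funM; first exact: measurable_powR.
exact: measurableT_comp.
Qed.

Lemma continuous_gamma_fun x t : 0 < t -> {for t, continuous (gamma_fun x)}.
Proof.
move=> t0; apply: continuousM.
  apply: differentiable_continuous; apply/derivable1_diffP.
  exact: (@ex_derive _ _ _ _ _ _ _ (is_derive1_powR (x - 1) t0)).
apply: continuous_comp; first exact: continuousN.
exact: continuous_expR.
Qed.

(** Compact intervals away from 0, on which the integrand is continuous and hence integrable for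
    every [x]. The shift by 2 keeps the two endpoints distinct, as the fundamental theorem of
    calculus demands. *)
Definition expanding n : set R := [set` `[(n.+2%:R)^-1, n.+2%:R]].

Lemma bigcup_expanding : \bigcup_n expanding n = [set` `]0%R, +oo[].
Proof.
apply/seteqP; split=> t /=.
  move=> [n _]; rewrite /expanding /= !in_itv/= andbT => /andP[+ _].
  by apply: lt_le_trans; rewrite invr_gt0 ltr0n.
rewrite in_itv/= andbT => t0.
pose N := maxn (Num.truncn t) (Num.truncn t^-1).
exists N => //; rewrite /expanding/= in_itv/=; apply/andP; split.
  rewrite invf_ple ?posrE ?ltr0n//.
  apply: ltW; apply: lt_le_trans (truncnS_gt _) _.
  by rewrite ler_nat ltnS leqW ?leq_maxr.
apply: ltW; apply: lt_le_trans (truncnS_gt _) _.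
by rewrite ler_nat ltnS leqW ?leq_maxl.
Qed.

(** Monotone convergence for a nonnegative integrand: it holds whether or not the limit is
    finite. *)
Lemma cvg_egamma x :
  (\int[mu]_(t in expanding n) (gamma_fun x t)%:E @[n --> \oo] --> egamma x)%E.
Proof.
rewrite /egamma -bigcup_expanding.
apply: ge0_nondecreasing_set_cvg_integral => //.
- apply/nondecreasing_seqP => n; rewrite subsetEset /expanding.
  apply: subset_itv; rewrite bnd_simp ?ler_nat//.
  by rewrite lef_pV2 ?posrE ?ltr0n// ler_nat.
- by move=> i; exact: measurable_itv.
- by move=> i; apply/measurable_EFinP; exact: measurable_gamma_fun.
- by move=> i t _; rewrite lee_fin gamma_fun_ge0.
Qed.

Lemma is_derive_gamma_fun x t : 0 < t ->
  is_derive t 1 (gamma_fun (x + 1)) (x * gamma_fun x t - gamma_fun (x + 1) t).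
Proof.
move=> t0.
have dE : is_derive t 1 (fun u : R => expR (- u)) (- expR (- t)).
  by apply: is_derive_eq; rewrite mulrN1.
have dF := is_deriveM (is_derive1_powR x t0) dE.
have -> : gamma_fun (x + 1) = (@powR R ^~ x) * (fun u => expR (- u)).
  by apply/funext => u; rewrite /gamma_fun addrK.
apply: is_derive_eq dF _; rewrite /gamma_fun /GRing.scale /=.
by rewrite mulrN addrC mulrC -mulrA.
Qed.

Lemma expanding_gt0 n t : expanding n t -> 0 < t.
Proof.
rewrite /expanding/= in_itv/= => /andP[+ _].
by apply: lt_le_trans; rewrite invr_gt0 ltr0n.
Qed.

Lemma within_continuous_gamma_fun x n :
  {within expanding n, continuous (gamma_fun x)}.
Proof.
apply: continuous_in_subspaceT => t; rewrite inE => /expanding_gt0.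
exact: continuous_gamma_fun.
Qed.

Lemma integrable_gamma_fun x n :
  mu.-integrable (expanding n) (EFin \o gamma_fun x).
Proof.
apply: continuous_compact_integrable; first exact: segment_compact.
exact: within_continuous_gamma_fun.
Qed.

(** Integration by parts, that is, the integral of the derivative of t^x e^(-t). Each boundary term
    stands on the side where it has a plus sign, so no subtraction of extended reals occurs and
    limits can be taken on both sides. *)
Lemma gamma_parts x n :
  (\int[mu]_(t in expanding n) (gamma_fun (x + 1) t)%:E
     + (gamma_fun (x + 1) n.+2%:R)%:E
   = x%:E * \int[mu]_(t in expanding n) (gamma_fun x t)%:E
     + (gamma_fun (x + 1) n.+2%:R^-1)%:E)%E.
Proof.
set a := n.+2%:R^-1; set b := n.+2%:R.
have ab : a < b.
  by rewrite /a /b (@lt_trans _ _ 1) ?ltr1n// invf_lt1 ?ltr0n ?ltr1n.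
have a0 : 0 < a by rewrite /a invr_gt0 ltr0n.
have b0 : 0 < b by exact: lt_trans ab.
pose f t := x * gamma_fun x t - gamma_fun (x + 1) t.
have FTC : (\int[mu]_(t in `[a, b]) (f t)%:E =
    (gamma_fun (x + 1) b)%:E - (gamma_fun (x + 1) a)%:E)%E.
  apply: continuous_FTC2 => //.
  - apply/subspace_continuousP => t tab; apply: cvgB.
      apply: cvgM; first exact: cvg_cst.
      have := @within_continuous_gamma_fun x n.
      by move/subspace_continuousP; exact.
    have := @within_continuous_gamma_fun (x + 1) n.
    by move/subspace_continuousP; exact.
  - split=> [t| |].
    + rewrite in_itv/= => /andP[at_ _].
      by have [] := is_derive_gamma_fun x (lt_trans a0 at_).
    + by apply: cvg_at_right_filter; exact: continuous_gamma_fun.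
    + by apply: cvg_at_left_filter; exact: continuous_gamma_fun.
  - move=> t; rewrite in_itv/= => /andP[at_ _].
    by rewrite derive1E; have [_ ->] := is_derive_gamma_fun x (lt_trans a0 at_).
have mE : measurable (expanding n) by exact: measurable_itv.
have iF y : mu.-integrable (expanding n) (fun t => (gamma_fun y t)%:E).
  exact: integrable_gamma_fun.
move: FTC; rewrite -/(expanding n).
have -> : (\int[mu]_(t in expanding n) (f t)%:E =
  x%:E * \int[mu]_(t in expanding n) (gamma_fun x t)%:E
  - \int[mu]_(t in expanding n) (gamma_fun (x + 1) t)%:E)%E.
  rewrite -integralZl//.
  rewrite -integralB_EFin//.
    have : mu.-integrable (expanding n) (fun t => x%:E * (gamma_fun x t)%:E)%E.
      by apply: integrableZl => //; exact: iF.
    exact.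
  exact: iF.
have fE y : (\int[mu]_(t in expanding n) (gamma_fun y t)%:E)%E \is a fin_num.
  by apply: integrable_fin_num => //; exact: iF.
have := fE x; have := fE (x + 1).
case: (\int[mu]_(t in expanding n) (gamma_fun (x + 1) t)%:E)%E => // u _.
case: (\int[mu]_(t in expanding n) (gamma_fun x t)%:E)%E => // v _.
move=> [] /eqP; rewrite subr_eq => /eqP uv.
by rewrite -!EFinM -!EFinD; congr (_%:E); rewrite uv; ring.
Qed.

Lemma gamma_fun_cvg0 x : 0 < x ->
  gamma_fun (x + 1) n.+2%:R^-1 @[n --> \oo] --> (0 : R).
Proof.
move=> x0.
have cv : (n.+2%:R^-1 : R) @[n --> \oo] --> (0 : R).
  have := @cvg_harmonic R; rewrite -(cvg_shiftn 1) /=.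
  by under eq_cvg do rewrite addn1.
apply: (@squeeze_cvgr _ _ _ _ (fun=> 0) (fun n : nat => (n.+2%:R^-1) `^ x)).
- near=> n; rewrite gamma_fun_ge0 /= /gamma_fun addrK ler_piMr ?powR_ge0//.
- exact: cvg_cst.
- have /cvg_at_rightP := powR_cvg0 x0; apply; split.
Unshelve. all: by end_near. Qed.

Lemma gamma_fun_cvgy x : 0 < x ->
  gamma_fun (x + 1) n.+2%:R @[n --> \oo] --> (0 : R).
Proof.
(* As x < N and t^(N+1) / (N+1)! is at most e^t, the value t^x e^(-t) is at most (N+1)! / t. *)
move=> x0; set N := (Num.truncn x).+1.
apply: (@squeeze_cvgr _ _ _ _ (fun=> 0)
          (fun n : nat => (N.+1)`!%:R * @harmonic R n)).
- near=> n; rewrite gamma_fun_ge0 /= /gamma_fun addrK.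
  set t : R := n.+2%:R; have t0 : 0 < t by rewrite ltr0n.
  have t1 : 1 <= t by rewrite ler1n.
  have xN : t `^ x <= t ^+ N.
    by rewrite -powR_mulrn ?(ltW t0)// ler_powR// ltW// truncnS_gt.
  have eN : t ^+ N.+1 / (N.+1)`!%:R <= expR t.
    by apply: le_trans (expR_ge1Dxn N (ltW t0)); rewrite lerDr.
  have f0 : (0 : R) < (N.+1)`!%:R by rewrite ltr0n fact_gt0.
  rewrite expRN ler_pdivrMr ?expR_gt0//; apply: le_trans xN _.
  apply: (@le_trans _ _ ((N.+1)`!%:R * t^-1 * (t ^+ N.+1 / (N.+1)`!%:R))).
    rewrite exprS le_eqVlt; apply/orP; left; apply/eqP; field.
    by rewrite !gt_eqF.
  apply: ler_pM => //.
  + by rewrite mulr_ge0 ?invr_ge0 ?ltW.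
  + by rewrite mulr_ge0 ?invr_ge0 ?exprn_ge0 ?ltW.
  + by rewrite ler_pM2l// lef_pV2 ?posrE ?ltr0n// ler_nat.
- exact: cvg_cst.
- rewrite -[X in _ --> X](mulr0 ((N.+1)`!%:R : R)).
  by apply: cvgM; [exact: cvg_cst|exact: cvg_harmonic].
Unshelve. all: by end_near. Qed.

(** Limit of [gamma_parts], whose boundary terms tend to 0. Both sides may still be infinite here,
    which lets the identity serve to prove finiteness. *)
Lemma egammaS x : 0 < x -> egamma (x + 1) = (x%:E * egamma x)%E.
Proof.
move=> x0.
have fE (u : nat -> R) (l : R) : u n @[n --> \oo] --> l ->
    (u n)%:E @[n --> \oo] --> l%:E.
  by move=> ul; apply: cvg_EFin => //; exact: nearW.
have fin0 : 0%:E \is a @fin_num R by [].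
have cl := cvgeD (fin_num_adde_defl (egamma (x + 1)) fin0)
  (@cvg_egamma (x + 1)) (fE _ _ (gamma_fun_cvgy x0)).
have cr := cvgeD (fin_num_adde_defl (x%:E * egamma x)%E fin0)
  (cvgeZl (isT : x%:E \is a fin_num) (@cvg_egamma x))
  (fE _ _ (gamma_fun_cvg0 x0)).
move: cl cr; rewrite !adde0 => cl cr.
rewrite -(cvg_lim (@ereal_hausdorff R) (cl _)).
rewrite -(cvg_lim (@ereal_hausdorff R) (cr _)).
by under eq_fun => n do rewrite gamma_parts.
Qed.

Lemma egamma_ge0 x : (0 <= egamma x)%E.
Proof. by apply: integral_ge0 => t _; rewrite lee_fin gamma_fun_ge0. Qed.

(* The truncated integrals of exp(- t) are bounded by the case x = 0 of
   gamma_parts. *)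
Lemma egamma1_lty : (egamma 1 < +oo)%E.
Proof.
apply: (@le_lt_trans _ _ 1%E); last exact: ltry.
apply: (cvge_to_le (@cvg_egamma 1)); near=> n.
have := gamma_parts 0 n; rewrite add0r mul0e add0e.
set a : R := n.+2%:R^-1 => e.
have a0 : 0 < a by rewrite invr_gt0 ltr0n.
apply: (@le_trans _ _ (gamma_fun 1 a)%:E).
  by rewrite -e leeDl// lee_fin gamma_fun_ge0.
by rewrite lee_fin /gamma_fun subrr powRr0 mul1r expR_le1 oppr_le0 ltW.
Unshelve. all: by end_near. Qed.

Lemma egamma_nat_lty n : (egamma n.+1%:R < +oo)%E.
Proof.
elim: n => [|n IHn]; first exact: egamma1_lty.
rewrite -natr1 egammaS ?ltr0n//; apply: lte_mul_pinfty => //.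
Qed.

(** Positivity: on [1, 2] the integrand is at least e^(-2). Finiteness: with N the integer part of
    x, t^(x-1) is at most 1 for t <= 1 and at most t^N for t > 1, so the integral is bounded by the
    sum of the values at 1 and N + 1. *)
Lemma egamma_ge1 x : 1 <= x -> (0 < egamma x < +oo)%E.
Proof.
move=> x1; apply/andP; split.
  apply: (@lt_le_trans _ _ (\int[mu]_(t in `[1%R, 2%R]) (expR (- 2))%:E)%E).
    rewrite integral_cst//= lebesgue_measure_itv/= lte_fin ltr1n.
    by rewrite mule_gt0 ?lte_fin ?expR_gt0// subr_gt0 ltr1n.
  apply: (@le_trans _ _ (\int[mu]_(t in `[1%R, 2%R]) (gamma_fun x t)%:E)%E).
    apply: ge0_le_integral => //.
    - by apply/measurable_EFinP; exact: measurable_gamma_fun.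
    move=> t; rewrite /= in_itv/= => /andP[t1 t2]; rewrite lee_fin /gamma_fun.
    rewrite -[leLHS]mul1r; apply: ler_pM; rewrite ?ler01 ?expR_ge0//.
      by rewrite -[leLHS](powRr0 t) ler_powR// subr_ge0.
    by rewrite ler_expR lerN2.
  apply: ge0_subset_integral => //.
  - by apply/measurable_EFinP; exact: measurable_gamma_fun.
  - by move=> t _; rewrite lee_fin gamma_fun_ge0.
  by apply: subset_itv; rewrite bnd_simp.
set N := Num.truncn x.
apply: (@le_lt_trans _ _ (egamma 1 + egamma N.+1%:R)%E); last first.
  by rewrite lte_add_pinfty ?egamma1_lty ?egamma_nat_lty.
rewrite /egamma -ge0_integralD//; first last.
- by apply/measurable_EFinP; exact: measurable_gamma_fun.
- by move=> t _; rewrite lee_fin gamma_fun_ge0.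
- by apply/measurable_EFinP; exact: measurable_gamma_fun.
- by move=> t _; rewrite lee_fin gamma_fun_ge0.
apply: ge0_le_integral => //.
- by move=> t _; rewrite lee_fin gamma_fun_ge0.
- by apply/measurable_EFinP; exact: measurable_gamma_fun.
- apply: emeasurable_funD; apply/measurable_EFinP;
    exact: measurable_gamma_fun.
move=> t; rewrite /= in_itv/= andbT => t0; rewrite -EFinD lee_fin.
rewrite /gamma_fun -mulrDl ler_wpM2r ?expR_ge0//.
have [t1|t1] := leP t 1.
  apply: (@le_trans _ _ (t `^ (1 - 1))); last by rewrite lerDl powR_ge0.
  by apply: ger_powR; rewrite ?t0// lerD2r.
apply: (@le_trans _ _ (t `^ (N.+1%:R - 1))); last by rewrite lerDr powR_ge0.
by rewrite ler_powR ?(ltW t1)// lerD2r ltW// truncnS_gt.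
Qed.

(** The value at x + 1 >= 1 is x times the value at x, so a value 0 or +oo at x would reappear at x
    + 1. *)
Lemma egamma_gt0_lty x : 0 < x -> (0 < egamma x < +oo)%E.
Proof.
move=> x0; have := @egamma_ge1 (x + 1); rewrite lerDr (ltW x0) egammaS//.
move=> /(_ isT); have := egamma_ge0 x.
case: (egamma x) => [r| |]//.
  by rewrite -EFinM !lte_fin !ltry pmulr_rgt0.
by rewrite mulry gtr0_sg// mul1e ltxx andbF.
Qed.

Lemma gamma_int_gt0 x : 0 < x -> 0 < EulerGamma.gamma_int x.
Proof. by move=> x0; rewrite gamma_intE fine_gt0// egamma_gt0_lty. Qed.

Lemma gamma_intS x : 0 < x ->
  EulerGamma.gamma_int (x + 1) = x * EulerGamma.gamma_int x.
Proof.
move=> x0; rewrite !gamma_intE egammaS// fineM//.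
have /andP[g0 gy] := egamma_gt0_lty x0.
by rewrite ge0_fin_numE ?ltW.
Qed.

Lemma pochS (x : R) k : poch x k.+1 = x * poch (x + 1) k.
Proof.
rewrite /poch big_ord_recl /= addr0; congr (_ * _).
by apply: eq_bigr => i _; rewrite /bump /= natrD addrA.
Qed.

Lemma poch_neq0 x k : (forall i : nat, x + i%:R != 0) -> poch x k != 0.
Proof. by move=> x0; apply/prodf_neq0 => i _. Qed.

(** Only the pole x = 0 is excluded: at the other poles both sides are 0, since the Pochhammer
    symbol in the denominator vanishes and the inverse of 0 is 0. *)
Lemma GammaS x : x != 0 -> Gamma (x + 1) = x * Gamma x.
Proof.
move=> x0; rewrite /Gamma.
have [xgt0|] := ltP 0 x.
  rewrite (addr_gt0 xgt0 ltr01) !addr0 gamma_intS//.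
  by rewrite /poch !big_ord0 !divr1.
rewrite le_eqVlt (negbTE x0)/= => xlt0.
have [x1|x1] := ltP 0 (x + 1).
  have -> : Num.truncn (- x) = 0%N.
    by apply/eqP; rewrite truncn_eq ?oppr_ge0 ?(ltW xlt0)//=; lra.
  rewrite /poch big_ord0 big_ord_recl big_ord0 /= !addr0 mulr1 divr1.
  by rewrite mulrCA divff// mulr1.
(* The shift used for [x] is one more than that for [x + 1]; both lead to the same integral, and the
   additional Pochhammer factor is [x]. *)
have -> : Num.truncn (- x) = (Num.truncn (- (x + 1))).+1.
  apply/eqP; rewrite truncn_eq ?oppr_ge0 ?(ltW xlt0)//.
  have /truncn_itv : 0 <= - (x + 1) by rewrite oppr_ge0.
  by rewrite -!natr1 => /andP[h1 h2]; apply/andP; split; lra.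
set k := (Num.truncn _).+1.
rewrite [poch x _]pochS invfM mulrCA [x * (_ * _)]mulrA divff// mul1r.
by rewrite -addrA nat1r.
Qed.

Lemma Gamma_neq0 x : (forall i : nat, x + i%:R != 0) -> Gamma x != 0.
Proof.
move=> x0; rewrite /Gamma mulf_neq0 ?invr_eq0 ?poch_neq0//.
rewrite gt_eqF// gamma_int_gt0//.
case: ifP => [|/negbT]; first by rewrite addr0.
by rewrite -leNgt => xle0; rewrite addrC -ltrBlDr sub0r truncnS_gt.
Qed.

Lemma Gamma_poch x k : (forall i : nat, x + i%:R != 0) ->
  Gamma (x + k%:R) = poch x k * Gamma x.
Proof.
move=> x0; elim: k => [|k IHk]; first by rewrite addr0 /poch big_ord0 mul1r.
by rewrite -natr1 addrA GammaS// IHk /poch big_ord_recr/= mulrCA mulrA.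
Qed.

End Gamma.
End GammaTheory.

(** * Parity and degree in superpolynomials in z and w *)

Section SuperVariables.
Variables (K : comNzRingType) (a b : nat).
Local Notation SP := (superpoly K a b).
Local Notation SPzw := (superpoly K (a + a) (b + b)).
Local Notation z := (@zvar K a b).
Local Notation w := (@wvar K a b).
Implicit Types (i j k : 'I_(a + b)) (f g : SPzw).

Definition odd_index i : bool := if split i is inr _ then true else false.

Definition koszul (p q : bool) : K := (-1) ^+ (p && q).

Lemma koszulC p q : koszul p q = koszul q p.
Proof. by rewrite /koszul andbC. Qed.

Lemma koszulK p q : koszul p q * koszul p q = 1.
Proof. by rewrite /koszul -expr2 sqrr_sign. Qed.

Lemma koszulDl p q r : koszul (p (+) q) r = koszul p r * koszul q r.
Proof.
by rewrite /koszul; case: p q r => [] [] []; rewrite /= ?mulN1r ?opprK ?mul1r.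
Qed.

Lemma spcoef_ederiv (c d : nat) (i : 'I_c) (f : superpoly K c d) D :
  spcoef (ederiv i f) D = mderiv i (spcoef f D).
Proof. exact: spcoefE. Qed.

Lemma spcoef_oderiv (c d : nat) (j : 'I_d) (f : superpoly K c d) D :
  spcoef (oderiv j f) D =
  if j \in D then 0
  else (-1) ^+ inversions [set j] D * spcoef f (j |: D).
Proof. exact: spcoefE. Qed.

Lemma spcoef_at_z0 f D : spcoef (at_z0 f) D =
  spcoef f [set rshift b j | j in D] \mPo
    [tuple match split i with inl _ => 0 | inr j => 'X_j end | i < a + a].
Proof. exact: spcoefE. Qed.

Lemma zderiv_linear k c f g :
  zderiv k (c *: f + g) = c *: zderiv k f + zderiv k g.
Proof.
apply/spolyP => D; rewrite /zderiv.
case: split => i; rewrite [RHS]spcoefD [in RHS]spcoefZ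
  ?spcoef_ederiv ?spcoef_oderiv spcoefD spcoefZ.
  by rewrite linearP.
case: ifP => _; first by rewrite scaler0 addr0.
by rewrite mulrDr scalerAr.
Qed.

Lemma at_z0_linear c f g : at_z0 (c *: f + g) = c *: at_z0 f + at_z0 g.
Proof.
apply/spolyP => D; rewrite [RHS]spcoefD [in RHS]spcoefZ.
rewrite !spcoef_at_z0 spcoefD spcoefZ.
by rewrite comp_mpolyD comp_mpolyZ.
Qed.

HB.instance Definition _ := GRing.isLinear.Build K SPzw SP _
  (@at_z0 K a b) at_z0_linear.

Lemma ovar_anticommM (c d : nat) (i j : 'I_d) (f : superpoly K c d) :
  ovar K c i * (ovar K c j * f) = - (ovar K c j * (ovar K c i * f)).
Proof. by rewrite mulrA ovar_anticomm mulNr mulrA. Qed.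

Lemma evar_swap (c d : nat) (i : 'I_c) (f g : superpoly K c d) :
  evar K d i * (f * g) = f * (evar K d i * g).
Proof. by rewrite mulrA evar_central mulrA. Qed.

Lemma zw_swap i j f : z i * (w j * f) =
  koszul (odd_index i) (odd_index j) *: (w j * (z i * f)).
Proof.
rewrite /koszul /odd_index /zvar /wvar.
case: (split i) => k; case: (split j) => l /=; rewrite ?scale1r ?scaleN1r.
- exact: evar_swap.
- exact: evar_swap.
- exact/esym/evar_swap.
- exact: ovar_anticommM.
Qed.

Lemma ww_swap i j f : w i * (w j * f) =
  koszul (odd_index i) (odd_index j) *: (w j * (w i * f)).
Proof.
rewrite /koszul /odd_index /wvar.
case: (split i) => k; case: (split j) => l /=; rewrite ?scale1r ?scaleN1r.
- exact: evar_swap.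
- exact: evar_swap.
- exact/esym/evar_swap.
- exact: ovar_anticommM.
Qed.

Lemma zderiv_z i j f :
  zderiv i (z j * f) =
    (i == j)%:R *: f
    + koszul (odd_index i) (odd_index j) *: (z j * zderiv i f).
Proof.
rewrite -(inj_eq (can_inj (@splitK a b))) /koszul /odd_index /zvar /zderiv.
case: (split i) => k; case: (split j) => l /=;
  rewrite ?scale1r ?scaleN1r ?scale0r ?add0r.
- by rewrite ederiv_evarM (inj_eq (@lshift_inj _ _)).
- by rewrite ederiv_ovarM.
- by rewrite oderiv_evarM.
- by rewrite oderiv_ovarM (inj_eq (@lshift_inj _ _)).
Qed.

Lemma zderiv_w i j f : zderiv i (w j * f) =
  koszul (odd_index i) (odd_index j) *: (w j * zderiv i f).
Proof.
rewrite /koszul /odd_index /wvar /zderiv.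
case: (split i) => k; case: (split j) => l /=; rewrite ?scale1r ?scaleN1r.
- by rewrite ederiv_evarM eq_lrshift scale0r add0r.
- by rewrite ederiv_ovarM.
- by rewrite oderiv_evarM.
- by rewrite oderiv_ovarM eq_lrshift scale0r add0r.
Qed.

Lemma zderiv1 i : zderiv i (1 : SPzw) = 0.
Proof.
apply/spolyP => D; rewrite /zderiv spcoef0.
case: split => k; rewrite ?spcoef_ederiv ?spcoef_oderiv !spcoef1.
  by rewrite -[_%:R]mpolyC_nat mderivC.
case: ifP => // _; case: eqP => [e|]; last by rewrite mulr0.
by have := setU11 (lshift b k) D; rewrite e inE.
Qed.

Lemma at_z0_1 : at_z0 (1 : SPzw) = 1.
Proof.
apply/spolyP => D; rewrite spcoef_at_z0 !spcoef1 imset_eq0.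
by rewrite -[_%:R]mpolyC_nat comp_mpolyC mpolyC_nat.
Qed.

Lemma at_z0_z i f : at_z0 (z i * f) = 0.
Proof.
apply/spolyP => D; rewrite spcoef_at_z0 spcoef0 /zvar.
case: (split i) => k.
  rewrite spcoef_evarM rmorphM /= comp_mpolyXU -tnth_nth tnth_mktuple.
  by rewrite -[lshift a k]/(unsplit (inl k)) unsplitK mul0r.
rewrite spcoef_ovarM ifF ?comp_mpoly0//.
by apply/negP => /imsetP[j _ /eqP]; rewrite eq_lrshift.
Qed.

Lemma inversions_rshift (A B : {set 'I_b}) :
  inversions [set rshift b j | j in A] [set rshift b j | j in B]
  = inversions A B.
Proof.
rewrite /inversions big_imset /=; last by move=> ? ? _ _; exact: rshift_inj.
apply: eq_bigr => i _.
rewrite big_imset /=; last by move=> ? ? _ _; exact: rshift_inj.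
by apply: eq_bigr => j _; rewrite ltn_add2l.
Qed.

Lemma at_z0_w i f : at_z0 (w i * f) = spvar K i * at_z0 f.
Proof.
apply/spolyP => D; rewrite spcoef_at_z0 /wvar /spvar.
case: (split i) => k.
  rewrite !spcoef_evarM spcoef_at_z0 rmorphM /=.
  rewrite comp_mpolyXU -tnth_nth tnth_mktuple.
  by rewrite -[rshift a k]/(unsplit (inr k)) unsplitK.
rewrite !spcoef_ovarM mem_imset; last exact: rshift_inj.
case: ifP => kD; last by rewrite comp_mpoly0.
have -> : [set rshift b j | j in D] :\ rshift b k
          = [set rshift b j | j in D :\ k].
  rewrite -{1}(setD1K kD) imsetU1 setU1K // mem_imset; last exact: rshift_inj.
  by rewrite !inE eqxx.
rewrite -imset_set1 inversions_rshift spcoef_at_z0.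
by rewrite rmorphM rmorph_sign.
Qed.


(* T has parity p and is linear over the superalgebra of the w's. *)
Definition w_super p (T : SPzw -> SPzw) : Prop :=
  (forall c f g, T (c *: f + g) = c *: T f + T g) /\
  (forall j f, T (w j * f) = koszul p (odd_index j) *: (w j * T f)).

Section WSuper.
Variables (p : bool) (T : SPzw -> SPzw).
Hypothesis sT : w_super p T.

Lemma w_super0 : T 0 = 0.
Proof. by have := sT.1 (-1) 0 0; rewrite scaler0 addr0 scaleN1r addNr. Qed.

Lemma w_superD f g : T (f + g) = T f + T g.
Proof. by have := sT.1 1 f g; rewrite !scale1r. Qed.

Lemma w_superZ c f : T (c *: f) = c *: T f.
Proof. by have := sT.1 c f 0; rewrite w_super0 !addr0. Qed.

Lemma w_super_bigsum (J : Type) (s : seq J) (P : pred J) F :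
  T (\sum_(i <- s | P i) F i) = \sum_(i <- s | P i) T (F i).
Proof. exact: (big_morph T w_superD w_super0). Qed.

End WSuper.

Lemma w_super_comp p q T U : w_super p T -> w_super q U ->
  w_super (p (+) q) (fun f => T (U f)).
Proof.
move=> sT sU; split=> [c f g|j f]; first by rewrite sU.1 sT.1.
by rewrite sU.2 (w_superZ sT) sT.2 scalerA koszulDl mulrC.
Qed.

(** The alternative [c x = 0] serves sums weighted by entries of beta or its inverse: terms of the
    wrong parity occur in them, but with coefficient zero. *)
Lemma w_super_lincomb (J : Type) (s : seq J) p (c : J -> K)
    (T : J -> SPzw -> SPzw) :
  (forall x, c x = 0 \/ w_super p (T x)) ->
  w_super p (fun f => \sum_(x <- s) c x *: T x f).
Proof.
move=> sT; split=> [d f g|j f].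
  rewrite scaler_sumr -big_split; apply: eq_bigr => i _ /=.
  case: (sT i) => [->|sTi]; first by rewrite !scale0r scaler0 addr0.
  by rewrite sTi.1 scalerDr !scalerA mulrC.
rewrite mulr_sumr scaler_sumr; apply: eq_bigr => i _ /=.
case: (sT i) => [->|sTi]; first by rewrite !scale0r mulr0 scaler0.
by rewrite sTi.2 -scalerAr !scalerA mulrC.
Qed.

Lemma w_super_sum (J : Type) (s : seq J) p (T : J -> SPzw -> SPzw) :
  (forall x, w_super p (T x)) -> w_super p (fun f => \sum_(x <- s) T x f).
Proof.
move=> sT; split=> [d f g|j f].
  by rewrite scaler_sumr -big_split; apply: eq_bigr => x _; rewrite (sT x).1.
rewrite mulr_sumr scaler_sumr.
by apply: eq_bigr => x _; rewrite (sT x).2.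
Qed.

Lemma w_super_add p T U : w_super p T -> w_super p U ->
  w_super p (fun f => T f + U f).
Proof.
move=> sT sU; split=> [c f g|j f]; first by rewrite sT.1 sU.1 scalerDr addrACA.
by rewrite sT.2 sU.2 mulrDr scalerDr.
Qed.

Lemma w_super_scale p c T : w_super p T -> w_super p (fun f => c *: T f).
Proof.
move=> sT; split=> [d f g|j f]; first by rewrite sT.1 scalerDr !scalerA mulrC.
by rewrite sT.2 -scalerAr !scalerA mulrC.
Qed.

Lemma w_super_opp p T : w_super p T -> w_super p (fun f => - T f).
Proof.
move=> /(w_super_scale (-1)) [lT wT].
by split=> [c f g|j f]; rewrite -!scaleN1r; [exact: lT|exact: wT].
Qed.

Lemma w_super_zderiv i : w_super (odd_index i) (@zderiv K a b i).
Proof. by split=> [c f g|j f]; [exact: zderiv_linear|exact: zderiv_w]. Qed.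

Lemma mul_lin u c f g : u * (c *: f + g) = c *: (u * f) + u * g :> SPzw.
Proof. by rewrite mulrDr scalerAr. Qed.

Lemma w_super_mulz i : w_super (odd_index i) (fun f => z i * f).
Proof. by split=> [c f g|j f]; [exact: mul_lin|exact: zw_swap]. Qed.

Lemma w_super_mulw i : w_super (odd_index i) (fun f => w i * f).
Proof. by split=> [c f g|j f]; [exact: mul_lin|exact: ww_swap]. Qed.

(* The only property of a polynomial of parity q in the w's that is needed. *)
Definition w_parity q (u : SPzw) : Prop := forall p T, w_super p T ->
  forall f, T (u * f) = koszul p q *: (u * T f).

Lemma w_parity_w j : w_parity (odd_index j) (w j).
Proof. by move=> p T sT f; rewrite sT.2. Qed.

Lemma w_parityM q r u v :
  w_parity q u -> w_parity r v -> w_parity (q (+) r) (u * v).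
Proof.
move=> pu pv p T sT f; rewrite -!mulrA (pu _ _ sT) (pv _ _ sT).
by rewrite -scalerAr scalerA [koszul p (_ (+) _)]koszulC koszulDl !(koszulC p).
Qed.

Lemma w_parity_lincomb (J : Type) (s : seq J) q (c : J -> K) (u : J -> SPzw) :
  (forall x, c x = 0 \/ w_parity q (u x)) ->
  w_parity q (\sum_(x <- s) c x *: u x).
Proof.
move=> pu p T sT f; rewrite !mulr_suml (w_super_bigsum sT) scaler_sumr.
apply: eq_bigr => i _; case: (pu i) => [->|pui].
  by rewrite !scale0r !mul0r (w_super0 sT) scaler0.
by rewrite -!scalerAl (w_superZ sT) (pui _ _ sT) !scalerA mulrC.
Qed.

Lemma w_parity_sum (J : Type) (s : seq J) q (u : J -> SPzw) :
  (forall x, w_parity q (u x)) -> w_parity q (\sum_(x <- s) u x).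
Proof.
move=> pu p T sT f; rewrite !mulr_suml (w_super_bigsum sT) scaler_sumr.
by apply: eq_bigr => x _; rewrite (pu x _ _ sT).
Qed.

Lemma w_parityZ q c u : w_parity q u -> w_parity q (c *: u).
Proof.
move=> pu p T sT f.
by rewrite -!scalerAl (w_superZ sT) (pu _ _ sT) !scalerA mulrC.
Qed.

Lemma w_super_mul q u : w_parity q u -> w_super q (fun f => u * f).
Proof.
move=> pu; split=> [c f g|j f]; first exact: mul_lin.
by rewrite (pu _ _ (w_super_mulw j)) scalerA koszulC koszulK scale1r.
Qed.


Lemma w_parity1 : w_parity false 1.
Proof. by move=> p T sT f; rewrite !mul1r /koszul andbF scale1r. Qed.

(** The parity may stay unnamed: moving B~(z_k) past the product and moving w_k past it give the
    same sign. *)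
Lemma w_parity_prod (s : seq 'I_(a + b)) :
  exists q, w_parity q (\prod_(i <- s) w i).
Proof.
elim: s => [|i s [q pq]].
  by exists false; rewrite big_nil; exact: w_parity1.
by exists (odd_index i (+) q); rewrite big_cons; exact/w_parityM/pq/w_parity_w.
Qed.

Lemma at_z0_prod_w (s : seq 'I_(a + b)) f :
  at_z0 (\prod_(i <- s) w i * f) = \prod_(i <- s) spvar K i * at_z0 f.
Proof.
elim: s => [|i s IHs]; first by rewrite !big_nil !mul1r.
by rewrite !big_cons -!mulrA at_z0_w IHs.
Qed.

(* The d-th power of the ideal generated by the z's. *)
Fixpoint z_order d f : Prop :=
  if d is d'.+1 then
    exists2 g : 'I_(a + b) -> SPzw, forall i, z_order d' (g i)
      & f = \sum_i z i * g i
  else True.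

Lemma z_order0 d : z_order d 0.
Proof.
elim: d => // d IHd; exists (fun=> 0) => //.
by rewrite big1 // => i _; rewrite mulr0.
Qed.

Lemma z_order_linear d c f g :
  z_order d f -> z_order d g -> z_order d (c *: f + g).
Proof.
elim: d f g => // d IHd f g [f' f'd ->] [g' g'd ->].
exists (fun i => c *: f' i + g' i) => [i|]; first exact: IHd (f'd i) (g'd i).
by rewrite scaler_sumr -big_split; apply: eq_bigr => i _; rewrite mul_lin.
Qed.

Lemma z_orderD d f g : z_order d f -> z_order d g -> z_order d (f + g).
Proof. by move=> df dg; rewrite -[f]scale1r; exact: z_order_linear. Qed.

Lemma z_orderZ d c f : z_order d f -> z_order d (c *: f).
Proof. by move=> df; rewrite -[_ *: f]addr0; apply/z_order_linear/z_order0. Qed.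

Lemma z_orderN d f : z_order d f -> z_order d (- f).
Proof. by rewrite -scaleN1r; exact: z_orderZ. Qed.

Lemma z_order_sum (J : Type) (s : seq J) d (F : J -> SPzw) :
  (forall x, z_order d (F x)) -> z_order d (\sum_(x <- s) F x).
Proof.
move=> dF; elim/big_rec: _ => [|x f _ df]; first exact: z_order0.
exact: z_orderD.
Qed.

Lemma z_order_mulz d i f : z_order d f -> z_order d.+1 (z i * f).
Proof.
move=> df; exists (fun k => if k == i then f else 0) => [k|].
  by case: eqP => _ //; exact: z_order0.
rewrite (bigD1 i) //= eqxx big1 ?addr0 // => k /negbTE->.
by rewrite mulr0.
Qed.

Lemma z_order_mulw d j f : z_order d f -> z_order d (w j * f).
Proof.
elim: d f => // d IHd f [g gd ->]; rewrite mulr_sumr; apply: z_order_sum => i.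
have -> : w j * (z i * g i) =
    koszul (odd_index i) (odd_index j) *: (z i * (w j * g i)).
  by rewrite zw_swap scalerA koszulK scale1r.
exact/z_orderZ/z_order_mulz/IHd/gd.
Qed.

Lemma z_order_zderiv d i f : z_order d.+1 f -> z_order d (zderiv i f).
Proof.
elim: d f => // d IHd f [g gd ->].
rewrite (w_super_bigsum (w_super_zderiv i)); apply: z_order_sum => k.
rewrite zderiv_z; apply: z_order_linear => //.
exact/z_orderZ/z_order_mulz/IHd/gd.
Qed.

Lemma at_z0_order d f : z_order d.+1 f -> at_z0 f = 0.
Proof.
case=> g _ ->; rewrite linear_sum big1 // => i _; exact: at_z0_z.
Qed.

End SuperVariables.

(** * Expansion of superpolynomials into ordered monomials *)

Section Monomials.
Variables (K : comNzRingType) (a b : nat).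
Local Notation SP := (superpoly K a b).

Lemma spcoef_sum (J : Type) (s : seq J) (P : pred J) (F : J -> SP) D :
  spcoef (\sum_(x <- s | P x) F x) D = \sum_(x <- s | P x) spcoef (F x) D.
Proof.
exact: (big_morph (fun f : SP => spcoef f D) (fun f g => spcoefD f g D)
  (spcoef0 K a D)).
Qed.

Lemma spvar_lshift (i : 'I_a) : spvar K (lshift b i) = evar K b i.
Proof. by rewrite /spvar -[lshift b i]/(unsplit (inl i)) unsplitK. Qed.

Lemma spvar_rshift (j : 'I_b) : spvar K (rshift a j) = ovar K a j.
Proof. by rewrite /spvar -[rshift a j]/(unsplit (inr j)) unsplitK. Qed.

Lemma spcoef_prod_evar (mu : 'X_{1..a}) (s : seq 'I_a) (f : SP) D :
  spcoef (\prod_(k <- flatten [seq nseq (mu i) (lshift b i) | i <- s])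
            spvar K k * f) D = \prod_(i <- s) 'X_i ^+ mu i * spcoef f D.
Proof.
elim: s f => [|i s IHs] f; first by rewrite /= !big_nil !mul1r.
rewrite /= big_cat big_cons -!mulrA -IHs; set g := \prod_(k <- _) _ * f.
elim: (mu i) => [|e IHe]; first by rewrite big_nil !mul1r.
by rewrite /= big_cons -mulrA spvar_lshift spcoef_evarM IHe exprS mulrA.
Qed.

(** A strictly increasing list has no inversions, so the product is a basis element without sign. *)
Lemma spcoef_prod_ovar (s : seq 'I_b) D : sorted ltn [seq val j | j <- s] ->
  spcoef (\prod_(j <- s) ovar K a j) D = (D == [set j in s])%:R.
Proof.
elim: s D => [|j s IHs] D ss.
  by rewrite big_nil spcoef1; congr (_ == _)%:R; apply/setP => k; rewrite !inE.
have js k : k \in s -> (j < k)%N.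
  move: ss => /= /(order_path_min ltn_trans)/allP js ks.
  by apply: js; exact: map_f.
have jNs : j \notin s by apply/negP => /js; rewrite ltnn.
rewrite big_cons spcoef_ovarM IHs; last exact: path_sorted ss.
have sE : [set k in j :: s] = j |: [set k in s].
  by apply/setP => k; rewrite !inE.
rewrite sE; case: ifPn => jD.
  have -> : (D :\ j == [set k in s]) = (D == j |: [set k in s]).
    apply/eqP/eqP => [<-|->]; first by rewrite setD1K.
    by rewrite setU1K ?inE.
  case: eqP => [->|_]; last by rewrite mulr0.
  rewrite setU1K ?inE // /inversions big_set1 big1 ?expr0 ?mul1r // => k.
  by rewrite inE => /js/ltnW; rewrite leqNgt => /negbTE->.
by case: eqP jD => // ->; rewrite setU11.
Qed.

Lemma sorted_enum_ord (D : {set 'I_b}) : sorted ltn [seq val j | j <- enum D].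
Proof.
rewrite /enum_mem; set s := Finite.enum _.
have : sorted ltn [seq val j | j <- s].
  by have := iota_ltn_sorted 0 b; rewrite -val_enum_ord enumT.
rewrite !sorted_map; apply: sorted_filter => x y t; exact: ltn_trans.
Qed.

Lemma spcoef_prod_factors (mu : 'X_{1..a}) (D E : {set 'I_b}) :
  spcoef (\prod_(k <- factors mu D) spvar K k) E = (E == D)%:R *: 'X_[mu].
Proof.
rewrite /factors big_cat /= spcoef_prod_evar big_map.
under [X in spcoef X _]eq_bigr do rewrite spvar_rshift.
rewrite spcoef_prod_ovar ?sorted_enum_ord //.
have -> : [set j in enum D] = D by apply/setP => j; rewrite inE mem_enum.
rewrite big_enum /= -mpolyXE_id.
by case: eqP => _; rewrite ?mulr1 ?scale1r ?mulr0 ?scale0r.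
Qed.

(** The shape is that of [subst_op], so that p and p(B~) can be compared monomial by monomial, with
    the same order of factors. *)
Lemma superpoly_expand (p : SP) :
  p = \sum_(D : {set 'I_b}) \sum_(mu <- msupp (spcoef p D))
        (spcoef p D)@_mu *: \prod_(k <- factors mu D) spvar K k.
Proof.
apply/spolyP => E; rewrite spcoef_sum (bigD1 E) //= [X in _ + X]big1 ?addr0.
  rewrite spcoef_sum [LHS]mpolyE; apply: eq_bigr => mu _.
  by rewrite spcoefZ spcoef_prod_factors eqxx scale1r.
move=> D nD; rewrite spcoef_sum big1 // => mu _.
by rewrite spcoefZ spcoef_prod_factors eq_sym (negbTE nD) scale0r scaler0.
Qed.

End Monomials.

(** * The matrix beta as a signed permutation matrix *)

Section Beta.
Variables (R : realType) (m n : nat).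
Hypothesis m_gt0 : (0 < m)%N.
Local Notation C := R[i].
Local Notation I := 'I_(m + 2 * n).
Local Notation beta := (beta R m n).
Implicit Types i j k : I.

Lemma odd_indexE i : odd_index i = (m <= i)%N.
Proof.
rewrite /odd_index; case: splitP => k ->; first by rewrite leqNgt ltn_ord.
by rewrite leq_addr.
Qed.

(** The permutation underlying beta: it fixes the even indices and exchanges m + i with m + n + i.
    The value is always in range, so the default of [insubd] is never taken. *)
Definition beta_dual i : I := insubd i
  (if i < m then i : nat else if i < m + n then i + n else i - n)%N.

Definition beta_sign i : C := (-1) ^+ ((i == 0%N :> nat) || (m <= i < m + n)%N).

Lemma val_beta_dual i : val (beta_dual i) =
  (if i < m then i : nat else if i < m + n then i + n else i - n)%N.
Proof.
rewrite /beta_dual val_insubd; have := ltn_ord i.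
by repeat case: ifP; lia.
Qed.

Lemma beta_dualK : involutive beta_dual.
Proof.
move=> i; apply: val_inj; rewrite !val_beta_dual /=; have := ltn_ord i.
by repeat case: ifP; lia.
Qed.

Lemma odd_beta_dual i : odd_index (beta_dual i) = odd_index i.
Proof.
rewrite !odd_indexE val_beta_dual; have := ltn_ord i.
by repeat case: ifP; lia.
Qed.

Lemma betaE i j : beta i j = (j == beta_dual i)%:R * beta_sign i.
Proof.
rewrite mxE -!(inj_eq val_inj) val_beta_dual /beta_sign.
have := ltn_ord i; have := ltn_ord j.
case: (ltnP i m) => im; case: (ltnP i (m + n)) => imn;
  case: (eqVneq (i : nat) 0%N) => i0 /=; (repeat case: ifP => ?); try case: eqP;
  rewrite ?mul1r ?mul0r // => *; exfalso; lia.
Qed.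

Lemma beta_sign_sqr i : beta_sign i * beta_sign i = 1.
Proof. by rewrite /beta_sign -expr2 sqrr_sign. Qed.

(** A signed permutation matrix is orthogonal; hence the inverse of beta is its transpose. *)
Lemma beta_tr_inv : beta *m beta^T = 1%:M.
Proof.
apply/matrixP => i k; rewrite !mxE (bigD1 (beta_dual i)) //= big1; last first.
  by move=> j /negbTE nj; rewrite betaE nj !mul0r.
rewrite addr0 [_^T _ _]mxE !betaE eqxx mul1r (inj_eq (can_inj beta_dualK)).
by case: eqP => [->|]; rewrite ?mul1r ?mul0r ?mulr0 ?beta_sign_sqr.
Qed.

Lemma beta_unit : beta \in unitmx.
Proof. by case: (mulmx1_unit beta_tr_inv). Qed.

Lemma beta_invE i j : invmx beta i j = beta j i.
Proof.
rewrite -[invmx beta]mulmx1 -beta_tr_inv mulmxA mulVmx ?beta_unit //.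
by rewrite mul1mx mxE.
Qed.

Lemma beta_mul_inv i k : \sum_j beta i j * invmx beta j k = (i == k)%:R.
Proof.
have := congr1 (fun M : 'M_(_) => M i k) (mulmxV beta_unit).
by rewrite !mxE.
Qed.

Lemma beta_inv_mul i k : \sum_j invmx beta i j * beta j k = (i == k)%:R.
Proof.
have := congr1 (fun M : 'M_(_) => M i k) (mulVmx beta_unit).
by rewrite !mxE.
Qed.

Lemma beta_odd i j : odd_index i != odd_index j -> beta i j = 0.
Proof.
move=> nij; rewrite betaE; case: eqP => [e|_]; last by rewrite mul0r.
by rewrite e odd_beta_dual eqxx in nij.
Qed.

Lemma beta_inv_odd i j : odd_index i != odd_index j -> invmx beta i j = 0.
Proof. by rewrite beta_invE eq_sym; exact: beta_odd. Qed.

(** Index 0 decouples from all others; this matches the separate summand 2 z_0 w_0 of z|w. *)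
Lemma beta_inv_index0 i j : (val i == 0%N) || (val j == 0%N) ->
  invmx beta i j = - (i == j)%:R.
Proof.
rewrite beta_invE mxE -!(inj_eq val_inj) /=.
have := ltn_ord i; have := ltn_ord j.
case: (eqVneq (i : nat) 0%N) => i0; case: (eqVneq (j : nat) 0%N) => j0 //=;
  (repeat case: ifP => ?); try case: eqP; rewrite ?oppr0 // => *; exfalso; lia.
Qed.

End Beta.

(** * Bessel operators applied to powers of z|w *)

Section Bessel.
Variables (R : realType) (m n : nat).
Hypothesis m_gt0 : (0 < m)%N.
Local Notation C := R[i].
Local Notation I := 'I_(m + 2 * n).
Local Notation Pz := (superpoly C m (2 * n)).
Local Notation Pzw := (superpoly C (m + m) (2 * n + 2 * n)).
Local Notation z := (@zvar C m (2 * n)).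
Local Notation w := (@wvar C m (2 * n)).
Local Notation beta := (beta R m n).
Local Notation beta_inv := (invmx beta).
Local Notation X := (zw R m n).
Implicit Types (i j k : I) (f g h : Pzw) (d : nat).

Lemma w_super_zpartial k : w_super (odd_index k) (@zpartial R m n k).
Proof.
apply: w_super_lincomb => i.
have [e|ne] := eqVneq (odd_index k) (odd_index i).
  by right; rewrite e; exact: w_super_zderiv.
by left; exact: beta_odd.
Qed.


Lemma beta_inv_super (T : I -> I -> Pzw -> Pzw) :
  (forall i j, w_super (odd_index i (+) odd_index j) (T i j)) ->
  w_super false (fun f => \sum_i \sum_j beta_inv i j *: T i j f).
Proof.
move=> sT; apply: w_super_sum => i; apply: w_super_lincomb => j.
have [e|ne] := eqVneq (odd_index i) (odd_index j).
  by right; have := sT i j; rewrite e addbb.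
by left; exact: beta_inv_odd.
Qed.

Lemma w_super_euler : w_super false (@euler R m n).
Proof.
apply: beta_inv_super => i j; apply: w_super_comp (w_super_zpartial j).
exact: w_super_mulz.
Qed.

Lemma w_super_laplace : w_super false (@laplace R m n).
Proof.
by apply: beta_inv_super => i j; apply: w_super_comp; exact: w_super_zpartial.
Qed.

Lemma w_super_bessel k : w_super (odd_index k) (@bessel R m n k).
Proof.
rewrite /bessel; apply: w_super_add.
  apply: w_super_add; first exact: w_super_scale (w_super_zpartial k).
  apply: w_super_scale; have := w_super_comp w_super_euler (w_super_zpartial k).
  by rewrite addFb.
apply: w_super_opp; have := w_super_comp (w_super_mulz _ k) w_super_laplace.
by rewrite addbF.
Qed.

Lemma w_super_bessel_mod k : w_super (odd_index k) (@bessel_mod R m n k).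
Proof.
rewrite /bessel_mod; case: (val k == 0%N); last exact: w_super_bessel.
exact: w_super_opp (w_super_bessel k).
Qed.

(* The variables w_0, ..., w_(m+2n-1) with the sign of w_0 changed, for which
   z|w is twice the bilinear form of beta^-1. *)
Definition wt j : Pzw := (-1) ^+ (j == 0%N :> nat) *: w j.

(** The right coefficient of z_i in z|w, hence also its left derivative with respect to z_i. *)
Definition zw_coef i : Pzw := 2%:R *: \sum_j beta_inv i j *: wt j.

Lemma zwE : X = \sum_i z i * zw_coef i.
Proof.
rewrite [RHS](bigID (fun i : I => val i == 0%N)) /zw /=; congr (_ + _).
  apply: eq_bigr => i i0; rewrite /zw_coef (bigD1 i) //= big1 => [|j nj].
    rewrite addr0 beta_inv_index0 ?i0 // eqxx /wt (i0 : (i == 0%N :> nat)).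
    by rewrite expr1 !scaleN1r opprK scalerAr.
  by rewrite beta_inv_index0 ?i0 // eq_sym (negbTE nj) oppr0 scale0r.
rewrite scaler_sumr; apply: eq_bigr => i i0.
rewrite /zw_coef -scalerAr; congr (_ *: _); rewrite mulr_sumr big_mkcond /=.
apply: eq_bigr => j _; rewrite -scalerAr /wt; case: ifP => j0.
  by rewrite (negbTE (j0 : (j != 0%N :> nat))) scale1r.
rewrite beta_inv_index0 ?(negbFE j0) ?orbT //.
have [e|_] := eqVneq i j; first by rewrite e j0 in i0.
by rewrite oppr0 scale0r.
Qed.

Lemma w_parity_wt j : w_parity (odd_index j) (wt j).
Proof. exact/w_parityZ/w_parity_w. Qed.

Lemma w_parity_zw_coef i : w_parity (odd_index i) (zw_coef i).
Proof.
apply: w_parityZ; apply: w_parity_lincomb => j.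
have [->|ne] := eqVneq (odd_index i) (odd_index j).
  by right; exact: w_parity_wt.
by left; exact: beta_inv_odd.
Qed.

(** X contains z's, so [w_parity] does not cover it; instead multiplication by X is treated as an
    operator. It is even because z_i and its coefficient have the same parity, and it follows that X
    commutes with polynomials in w. *)
Lemma w_super_mulX : w_super false (fun f => X * f).
Proof.
have [lT wT] : w_super false (fun f => \sum_i z i * (zw_coef i * f)).
  apply: w_super_sum => i; rewrite -(addbb (odd_index i)).
  exact: w_super_comp (w_super_mulz _ i) (w_super_mul (w_parity_zw_coef i)).
have XE f : X * f = \sum_i z i * (zw_coef i * f).
  by rewrite zwE mulr_suml; apply: eq_bigr => i _; rewrite mulrA.
by split=> [c f g|j f]; rewrite !XE; [exact: lT|exact: wT].
Qed.

Lemma w_parity_mulX q u f : w_parity q u -> u * (X * f) = X * (u * f).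
Proof. by move=> pu; rewrite (pu _ _ w_super_mulX) /koszul expr0 scale1r. Qed.

(** The derivation passes z_k and then its coefficient, which has the same parity; the two Koszul
    signs cancel and the Leibniz rule for X carries no sign. *)
Lemma zderiv_zwM i f : zderiv i (X * f) = zw_coef i * f + X * zderiv i f.
Proof.
rewrite zwE !mulr_suml (w_super_bigsum (w_super_zderiv _ i)).
rewrite [in LHS](eq_bigr (fun k => (i == k)%:R *: (zw_coef k * f) +
    z k * zw_coef k * zderiv i f)) => [|k _].
  rewrite big_split /= (bigD1 i) //= eqxx scale1r big1 ?addr0 // => k nk.
  by rewrite eq_sym (negbTE nk) scale0r.
rewrite -!mulrA zderiv_z (w_parity_zw_coef k (w_super_zderiv _ _)).
by rewrite -scalerAr scalerA koszulK scale1r.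
Qed.

Lemma zderiv_zwXS i d :
  zderiv i (X ^+ d.+1) = d.+1%:R *: (zw_coef i * X ^+ d).
Proof.
elim: d => [|d IHd].
  by rewrite -[X ^+ 1]mulr1 zderiv_zwM zderiv1 mulr0 addr0 scale1r expr0.
rewrite exprS zderiv_zwM IHd -scalerAr.
rewrite -(w_parity_mulX _ (w_parity_zw_coef i)) -exprS.
by rewrite -[X in X + _]scale1r -scalerDl nat1r.
Qed.

Lemma beta_zw_coef k : \sum_i beta k i *: zw_coef i = 2%:R *: wt k.
Proof.
rewrite /zw_coef; under eq_bigr do rewrite scalerA mulrC -scalerA scaler_sumr.
rewrite -scaler_sumr exchange_big /=; congr (_ *: _).
rewrite (bigD1 k) //= [X in _ + X]big1 => [|j nj].
  rewrite addr0; under eq_bigr do rewrite scalerA.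
  by rewrite -scaler_suml beta_mul_inv // eqxx scale1r.
under eq_bigr do rewrite scalerA.
by rewrite -scaler_suml beta_mul_inv // eq_sym (negbTE nj) scale0r.
Qed.

Lemma zpartial_zwXS k d :
  zpartial k (X ^+ d.+1) = (2 * d.+1)%:R *: (wt k * X ^+ d).
Proof.
rewrite /zpartial; under eq_bigr do rewrite zderiv_zwXS scalerA mulrC -scalerA.
rewrite -scaler_sumr; under eq_bigr do rewrite scalerAl.
by rewrite -mulr_suml beta_zw_coef -scalerAl scalerA -natrM (mulnC 2 d.+1).
Qed.

Lemma zpartial1 k : zpartial k (1 : Pzw) = 0.
Proof. by rewrite /zpartial big1 // => i _; rewrite zderiv1 scaler0. Qed.

(** Contracting the inverse of beta with the beta inside [zpartial] leaves the usual Euler operator,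
    which counts the degree in z. *)
Lemma eulerE f : euler f = \sum_i z i * zderiv i f.
Proof.
apply: eq_bigr => i _; rewrite /zpartial.
under eq_bigr do rewrite mulr_sumr scaler_sumr.
rewrite exchange_big /= (bigD1 i) //= [X in _ + X]big1 => [|k nk].
  rewrite addr0; under eq_bigr do rewrite -scalerAr scalerA.
  by rewrite -scaler_suml beta_inv_mul // eqxx scale1r.
under eq_bigr do rewrite -scalerAr scalerA.
by rewrite -scaler_suml beta_inv_mul // eq_sym (negbTE nk) scale0r.
Qed.

Lemma euler_zwX d : euler (X ^+ d) = d%:R *: X ^+ d.
Proof.
rewrite eulerE; case: d => [|d].
  by rewrite scale0r big1 // => i _; rewrite zderiv1 mulr0.
under eq_bigr do rewrite zderiv_zwXS -scalerAr mulrA.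
by rewrite -scaler_sumr -mulr_suml -zwE -exprS.
Qed.

Definition R2w : Pzw := \sum_i \sum_j beta_inv i j *: (w i * w j).

(** w_0 enters R_w^2 only through its square, so the change of its sign is invisible. *)
Lemma R2wE : R2w = \sum_i \sum_j beta_inv i j *: (wt i * wt j).
Proof.
apply: eq_bigr => i _; apply: eq_bigr => j _.
rewrite /wt -scalerAl -scalerAr scalerA [RHS]scalerA -mulrA -signr_addb.
have [e|ne] := eqVneq i j; first by rewrite e addbb mulr1.
case i0: (i == 0%N :> nat).
  rewrite beta_inv_index0 ?(i0 : val i == 0%N) // (negbTE ne).
  by rewrite oppr0 !(mul0r, scale0r).
case j0: (j == 0%N :> nat); last by rewrite mulr1.
rewrite beta_inv_index0 ?(j0 : val j == 0%N) ?orbT // (negbTE ne).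
by rewrite oppr0 !(mul0r, scale0r).
Qed.

Lemma w_parity_R2w : w_parity false R2w.
Proof.
apply: w_parity_sum => i; apply: w_parity_lincomb => j.
have [e|ne] := eqVneq (odd_index i) (odd_index j).
  right.
  have := w_parityM (@w_parity_w C _ (2 * n) i) (@w_parity_w C _ (2 * n) j).
  by rewrite e addbb.
by left; exact: beta_inv_odd.
Qed.

Lemma w_super_R2w p T f : w_super p T -> T (R2w * f) = R2w * T f.
Proof.
by move=> sT; rewrite (w_parity_R2w sT) /koszul andbF expr0 scale1r.
Qed.

(** The two derivatives contribute 2 (d+2) and 2 (d+1). Moving the derivative of index i past [wt j]
    gives the same sign as exchanging [wt j] and [wt i], so the sums agree term by term. *)
Lemma laplace_zwXSS d :
  laplace (X ^+ d.+2) = (4 * (d.+1 * d.+2))%:R *: (R2w * X ^+ d).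
Proof.
rewrite R2wE mulr_suml scaler_sumr; apply: eq_bigr => i _.
rewrite mulr_suml scaler_sumr; apply: eq_bigr => j _.
rewrite zpartial_zwXS (w_superZ (w_super_zpartial i)).
rewrite (w_parity_wt j (w_super_zpartial i)) zpartial_zwXS.
rewrite -[_ *: (wt i * wt j) * _]scalerAl -[wt i * wt j * _]mulrA.
rewrite (w_parity_wt j (w_super_mul (w_parity_wt i))).
rewrite -[wt j * (_ *: _)]scalerAr !scalerA !natrM.
by congr (_ *: _); ring.
Qed.

Lemma laplace1 : laplace (1 : Pzw) = 0.
Proof.
rewrite /laplace big1 // => i _; rewrite big1 // => j _.
by rewrite zpartial1 (w_super0 (w_super_zpartial i)) scaler0.
Qed.

Lemma laplace_zw : laplace X = 0.
Proof.
rewrite /laplace big1 // => i _; rewrite big1 // => j _.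
rewrite -[X]expr1 zpartial_zwXS (w_superZ (w_super_zpartial i)).
by rewrite (w_parity_wt j (w_super_zpartial i)) zpartial1 mulr0 !scaler0.
Qed.

(** Right multiples of R_w^2 suffice: being even in the w's, it moves to the front through every
    [w_super] operator. *)
Definition eq_modR2w f g : Prop := exists h, f = g + R2w * h.

Lemma laplace_zwX d : exists h, laplace (X ^+ d) = R2w * h.
Proof.
case: d => [|[|d]].
- by exists 0; rewrite laplace1 mulr0.
- by exists 0; rewrite laplace_zw mulr0.
- by exists ((4 * (d.+1 * d.+2))%:R *: X ^+ d); rewrite laplace_zwXSS scalerAr.
Qed.

(** The derivative of X^(d+1) is 2 (d+1) times [wt k * X ^+ d], on which 2E acts as 2d; the
    Laplacian only contributes to the remainder. *)
Lemma bessel_zwXS k d : eq_modR2w (bessel k (X ^+ d.+1))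
  ((((superdim m n - 2)%:~R + 2 * d%:R) * (2 * d.+1%:R)) *: (wt k * X ^+ d)).
Proof.
have [h lapE] := laplace_zwX d.+1.
have zR : z k * (R2w * h) = R2w * (z k * h).
  exact: w_super_R2w h (w_super_mulz _ k).
exists (- (z k * h)); rewrite /bessel lapE zR mulrN; congr (_ - _).
rewrite zpartial_zwXS (w_superZ w_super_euler).
rewrite (w_parity_wt k w_super_euler) /koszul expr0 scale1r euler_zwX.
rewrite -scalerAr !scalerA -scalerDl; congr (_ *: _).
by rewrite natrM; ring.
Qed.

(** The sign that distinguishes [bessel_mod] at index 0 turns [wt] back into [w]. *)
Lemma bessel_mod_zwXS k d : eq_modR2w (bessel_mod k (X ^+ d.+1))
  ((((superdim m n - 2)%:~R + 2 * d%:R) * (2 * d.+1%:R)) *: (w k * X ^+ d)).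
Proof.
have [h bE] := bessel_zwXS k d; rewrite /bessel_mod bE {bE} /wt.
case: eqP => k0.
  exists (- h); rewrite opprD mulrN; congr (_ + _).
  by rewrite expr1 scaleN1r mulNr scalerN opprK.
by exists h; rewrite [(-1) ^+ _]expr0 scale1r.
Qed.

Lemma bessel_mod1 k : bessel_mod k (1 : Pzw) = 0.
Proof.
rewrite /bessel_mod /bessel laplace1 zpartial1 (w_super0 w_super_euler).
by rewrite mulr0 !scaler0 addr0 subr0 oppr0 if_same.
Qed.

End Bessel.

(** * Invariance of the powers of z|w under conjugation *)

Section Conj.
Variables (R : realType) (m n : nat).
Hypothesis m_gt0 : (0 < m)%N.
Local Notation C := R[i].
Local Notation I := 'I_(m + 2 * n).
Local Notation Pzw := (superpoly C (m + m) (2 * n + 2 * n)).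
Local Notation z := (@zvar C m (2 * n)).
Local Notation w := (@wvar C m (2 * n)).
Local Notation beta_inv := (invmx (beta R m n)).
Local Notation X := (zw R m n).
Implicit Types (i j k : I) (f g h : Pzw) (d : nat).

Lemma spcoef_conj f D : spcoef (conj_sp f) D = map_mpoly conjc (spcoef f D).
Proof. exact: spcoefE. Qed.

Lemma conj_spD f g : conj_sp (f + g) = conj_sp f + conj_sp g.
Proof.
apply/spolyP => D; rewrite [RHS]spcoefD [LHS]spcoef_conj spcoefD rmorphD.
by congr (_ + _); rewrite spcoef_conj.
Qed.

Lemma conj_sp0 : conj_sp (0 : Pzw) = 0.
Proof. by apply/spolyP => D; rewrite [LHS]spcoef_conj !spcoef0 rmorph0. Qed.

Lemma conj_spZ (c : C) f : conj_sp (c *: f) = (c^*)%C *: conj_sp f.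
Proof.
apply/spolyP => D; rewrite [RHS]spcoefZ [LHS]spcoef_conj spcoefZ map_mpolyZ.
by congr (_ *: _); rewrite spcoef_conj.
Qed.

Lemma conj_sp_sum (J : Type) (s : seq J) (P : pred J) (F : J -> Pzw) :
  conj_sp (\sum_(x <- s | P x) F x) = \sum_(x <- s | P x) conj_sp (F x).
Proof. exact: (big_morph _ conj_spD conj_sp0). Qed.

Lemma conj_sp1 : conj_sp (1 : Pzw) = 1.
Proof.
by apply/spolyP => D; rewrite [LHS]spcoef_conj !spcoef1 rmorph_nat.
Qed.

Lemma conj_sp_evarM (i : 'I_(m + m)) f :
  conj_sp (evar C _ i * f) = evar C _ i * conj_sp f.
Proof.
apply/spolyP => D; rewrite [RHS]spcoef_evarM [LHS]spcoef_conj spcoef_evarM.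
by rewrite rmorphM /= map_mpolyX; congr (_ * _); rewrite spcoef_conj.
Qed.

Lemma conj_sp_ovarM (j : 'I_(2 * n + 2 * n)) f :
  conj_sp (ovar C _ j * f) = ovar C _ j * conj_sp f.
Proof.
apply/spolyP => D; rewrite [RHS]spcoef_ovarM [LHS]spcoef_conj spcoef_ovarM.
case: ifP => _; last by rewrite rmorph0.
by rewrite rmorphM rmorph_sign; congr (_ * _); rewrite spcoef_conj.
Qed.

Lemma conj_sp_zM i f : conj_sp (z i * f) = z i * conj_sp f.
Proof.
by rewrite /zvar; case: split => k; [exact: conj_sp_evarM|exact: conj_sp_ovarM].
Qed.

Lemma conj_sp_wM i f : conj_sp (w i * f) = w i * conj_sp f.
Proof.
by rewrite /wvar; case: split => k; [exact: conj_sp_evarM|exact: conj_sp_ovarM].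
Qed.

Lemma conj_beta_inv i j : ((beta_inv i j)^*)%C = beta_inv i j.
Proof.
rewrite beta_invE // mxE.
by repeat case: ifP => _; rewrite ?rmorphN ?rmorph1 ?rmorph0.
Qed.

Lemma conj_sp_zwM f : conj_sp (X * f) = X * conj_sp f.
Proof.
rewrite zwE // !mulr_suml conj_sp_sum; apply: eq_bigr => i _.
rewrite -!mulrA conj_sp_zM /zw_coef -!scalerAl conj_spZ rmorph_nat.
rewrite !mulr_suml conj_sp_sum; congr (_ * (_ *: _)).
apply: eq_bigr => j _; rewrite -!scalerAl !conj_spZ conj_beta_inv conj_sp_wM.
by rewrite rmorph_sign.
Qed.

(** The second block of variables is reinterpreted from conjugates of the w's to the w's, so
    conjugation only acts on coefficients, and those of X are real because beta is. *)
Lemma conj_sp_zwX d : conj_sp (X ^+ d) = X ^+ d.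
Proof.
elim: d => [|d IHd]; first by rewrite expr0 conj_sp1.
by rewrite exprS conj_sp_zwM IHd.
Qed.

End Conj.

(** * The reproducing property *)

Section Reproducing.
Variables (R : realType) (m n : nat).
Hypothesis m_gt0 : (0 < m)%N.
Local Notation C := R[i].
Local Notation I := 'I_(m + 2 * n).
Local Notation Pz := (superpoly C m (2 * n)).
Local Notation Pzw := (superpoly C (m + m) (2 * n + 2 * n)).
Local Notation z := (@zvar C m (2 * n)).
Local Notation w := (@wvar C m (2 * n)).
Local Notation beta_inv := (invmx (beta R m n)).
Local Notation X := (zw R m n).
Local Notation R2w := (R2w R m n).
Local Notation half := (half_superdim R m n).
Implicit Types (i j k : I) (f g h : Pzw) (d : nat).
Hypothesis half_neq0 : forall l : nat, half - 1 + l%:R != 0.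

Definition kernel_coef d : R := (4 ^+ d * d`!%:R)^-1 * (poch (half - 1) d)^-1.

Lemma rep_kernelE d :
  rep_kernel R m n d = real_complex R (kernel_coef d) *: X ^+ d.
Proof.
rewrite /rep_kernel /besselI_sqrt scalerA -rmorphM.
congr (real_complex _ _ *: _).
rewrite /besselI_coef /kernel_coef.
have -> : d%:R + (half - 2) + 1 = half - 1 + d%:R by ring.
rewrite GammaTheory.Gamma_poch //.
have G0 := GammaTheory.Gamma_neq0 half_neq0.
have P0 := GammaTheory.poch_neq0 d half_neq0.
have f0 : d`!%:R != 0 :> R by rewrite pnatr_eq0 -lt0n fact_gt0.
have -> : (1 / 2 : R) ^+ (2 * d) = (4 ^+ d)^-1.
  by rewrite exprM -exprVn; congr (_ ^+ _); field.
have F0 : (4 : R) ^+ d != 0 by rewrite expf_neq0 // pnatr_eq0.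
by field; rewrite G0 P0 f0 F0.
Qed.

(** The multiplier is 4 (d+1) (a+d), the factor with which B~(z_k) takes X^(d+1) to w_k X^d modulo
    R_w^2; the kernel coefficients solve this recursion with initial value 1. *)
Lemma kernel_coefS d :
  kernel_coef d.+1 * (2 * (half - 1 + d%:R) * (2 * d.+1%:R)) = kernel_coef d.
Proof.
rewrite /kernel_coef factS exprS natrM.
have -> : poch (half - 1) d.+1 = poch (half - 1) d * (half - 1 + d%:R).
  by rewrite /poch big_ord_recr.
have P0 := GammaTheory.poch_neq0 d half_neq0.
have f0 : d`!%:R != 0 :> R by rewrite pnatr_eq0 -lt0n fact_gt0.
have F0 : (4 : R) ^+ d != 0 by rewrite expf_neq0 // pnatr_eq0.
have h0 := half_neq0 d.
have s0 : d.+1%:R != 0 :> R by rewrite pnatr_eq0.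
(* Generalising makes d + 1 and a + d atoms for [field], matching the nonvanishing hypotheses. *)
move: (d.+1%:R) s0 (half - 1 + d%:R) h0 => u u0 v v0.
by field; rewrite P0 f0 F0 u0 v0.
Qed.

Lemma bessel_eigenvalueE d :
  (superdim m n - 2)%:~R + 2 * d%:R = real_complex R (2 * (half - 1 + d%:R)).
Proof.
have -> : 2 * (half - 1 + d%:R) = (superdim m n - 2)%:~R + 2 * d%:R.
  have e2 : (2 : int)%:~R = 2 :> R by [].
  by rewrite /half_superdim [(superdim m n - 2)%:~R]intrB e2; field.
by rewrite (rmorphD (real_complex R)) (rmorphM (real_complex R))
  (rmorph_int (real_complex R)) !(rmorph_nat (real_complex R)).
Qed.

Local Notation Kt d := (rep_kernel R m n d).

Lemma bessel_mod_kernelS k d :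
  eq_modR2w (bessel_mod k (Kt d.+1)) (w k * Kt d).
Proof.
have [h e] := bessel_mod_zwXS R m_gt0 k d.
exists (real_complex R (kernel_coef d.+1) *: h).
have ce : real_complex R (kernel_coef d.+1) *
    (((superdim m n - 2)%:~R + 2 * d%:R) * (2 * d.+1%:R))
    = real_complex R (kernel_coef d).
  rewrite bessel_eigenvalueE -(kernel_coefS d).
  rewrite [RHS](rmorphM (real_complex R)); congr (_ * _).
  rewrite [RHS](rmorphM (real_complex R)); congr (_ * _).
  by rewrite (rmorphM (real_complex R)) !(rmorph_nat (real_complex R)).
rewrite !rep_kernelE (w_superZ (w_super_bessel_mod R m_gt0 k)) e scalerDr.
by rewrite [in LHS]scalerA ce -(scalerAr _ (w k)) -(scalerAr _ R2w).
Qed.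

Lemma rep_kernel0 : Kt 0 = 1.
Proof.
rewrite rep_kernelE /kernel_coef /poch big_ord0 fact0 expr0 mulr1 invr1 mulr1.
by rewrite rmorph1 expr0 scale1r.
Qed.

Lemma bessel_mod_kernel0 k : bessel_mod k (Kt 0) = 0.
Proof. by rewrite rep_kernel0 bessel_mod1. Qed.

(** [foldr] applies the last factor first. A new B~(z_k) passes the product of w's already produced,
    and the w_k that it creates moves to the front with the same sign; the factors thus come out in
    the order of [s]. *)
Lemma foldr_bessel_mod (s : seq I) d :
  eq_modR2w (foldr (@bessel_mod R m n) (Kt d) s)
    (if (size s <= d)%N then \prod_(k <- s) w k * Kt (d - size s) else 0).
Proof.
elim: s => [|k s [h IHs]].
  by exists 0; rewrite big_nil mul1r subn0 mulr0 addr0.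
have sB := w_super_bessel_mod R m_gt0 k.
rewrite /= IHs (w_superD sB) (w_super_R2w m_gt0 _ sB).
case: (ltnP (size s) d) => [sd|ds]; last first.
  exists (bessel_mod k h); rewrite add0r.
  (* If [size s <= d], the two are equal and the product multiplies K_0 = 1, which every B~(z_k)
     kills; otherwise the main term is already 0. *)
  case: (leqP _ d) => [sd|_]; last first.
    by rewrite (w_super0 sB) add0r.
  have -> : (d - size s)%N = 0%N by apply/eqP; rewrite subn_eq0.
  have [q pq] := w_parity_prod C s.
  by rewrite (pq _ _ sB) bessel_mod_kernel0 mulr0 scaler0 add0r.
rewrite (ltnW sd) subnS; have [q pq] := w_parity_prod C s.
rewrite (pq _ _ sB) -(prednK (n := d - size s)) ?subn_gt0 //.
have [h' ->] := bessel_mod_kernelS k (d - size s).-1.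
exists (koszul C (odd_index k) q *: (\prod_(i <- s) w i * h') + bessel_mod k h).
rewrite !mulrDr scalerDr addrA; congr (_ + _ + _).
  by rewrite big_cons -mulrA (pq _ _ (w_super_mulw C k)) prednK ?subn_gt0.
have WR : \prod_(i <- s) w i * (R2w * h') = R2w * (\prod_(i <- s) w i * h').
  exact: (w_super_R2w m_gt0 h' (w_super_mul pq)).
by rewrite WR scalerAr.
Qed.

Lemma at_z0_R2w f : at_z0 (R2w * f) = R2 R m n * at_z0 f.
Proof.
rewrite !mulr_suml linear_sum; apply: eq_bigr => i _.
rewrite !mulr_suml linear_sum; apply: eq_bigr => j _ /=.
rewrite -(scalerAl _ (w i * w j)) linearZ /= -(scalerAl _ (spvar C i * _)).
by rewrite -(mulrA (w i)) -(mulrA (spvar C i)) at_z0_w at_z0_w.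
Qed.

Lemma z_order_zpartial d k f : z_order d.+1 f -> z_order d (zpartial k f).
Proof.
by move=> df; apply: z_order_sum => i; exact/z_orderZ/z_order_zderiv.
Qed.

Lemma z_order_euler d f : z_order d f -> z_order d (euler f).
Proof.
case: d => // d df; apply: z_order_sum => i; apply: z_order_sum => j.
exact/z_orderZ/z_order_mulz/z_order_zpartial.
Qed.

(** The Laplacian lowers the order by two and z_k raises it by one; for [d = 0] there is nothing to
    prove. *)
Lemma z_order_mulz_laplace d k f :
  z_order d.+1 f -> z_order d (z k * laplace f).
Proof.
case: d => // d df.
apply/z_order_mulz/z_order_sum => i; apply: z_order_sum => j.
exact/z_orderZ/z_order_zpartial/z_order_zpartial.
Qed.

Lemma z_order_bessel_mod d k f : z_order d.+1 f -> z_order d (bessel_mod k f).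
Proof.
move=> df; have dk : z_order d (bessel k f).
  apply: z_orderD; last exact/z_orderN/z_order_mulz_laplace.
  apply: z_orderD; apply/z_orderZ; last apply: z_order_euler.
    exact: z_order_zpartial.
  exact: z_order_zpartial.
by rewrite /bessel_mod; case: ifP => _ //; exact: z_orderN.
Qed.

Lemma z_order_foldr_bessel_mod d (s : seq I) f :
  z_order (size s + d) f -> z_order d (foldr (@bessel_mod R m n) f s).
Proof.
elim: s d => // k s IHs d /= df; apply/z_order_bessel_mod/IHs.
by rewrite addnS.
Qed.

Lemma z_order_zwX d : z_order d (X ^+ d).
Proof.
elim: d => // d IHd; rewrite exprS {1}zwE // mulr_suml.
apply: z_order_sum => i; rewrite -mulrA; apply: z_order_mulz.
rewrite /zw_coef -scalerAl mulr_suml; apply/z_orderZ/z_order_sum => j.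
rewrite /wt -scalerAl -scalerAl; apply: z_orderZ; apply: z_orderZ.
by apply: z_order_mulw; exact: IHd.
Qed.

(** Exact vanishing, which the congruence in [foldr_bessel_mod] cannot give, since its remainder may
    survive at z = 0. It makes the series a finite sum of superpolynomials and not merely of
    classes. *)
Lemma at_z0_foldr_gt (s : seq I) d : (size s < d)%N ->
  at_z0 (foldr (@bessel_mod R m n) (Kt d) s) = 0.
Proof.
move=> sd; apply: (@at_z0_order _ _ _ (d - size s).-1).
apply: z_order_foldr_bessel_mod; rewrite prednK ?subn_gt0 //.
rewrite subnKC ?(ltnW sd) // rep_kernelE; exact/z_orderZ/z_order_zwX.
Qed.

Lemma sum_at_z0_foldr (s : seq I) N : (size s < N)%N -> exists h : Pz,
  \sum_(d < N) at_z0 (foldr (@bessel_mod R m n) (Kt d) s)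
  = \prod_(k <- s) spvar C k + R2 R m n * h.
Proof.
move=> sN.
have at0 d : (d < size s)%N -> exists h : Pz,
    at_z0 (foldr (@bessel_mod R m n) (Kt d) s) = R2 R m n * h.
  move=> ds; have [h ->] := foldr_bessel_mod s d.
  by exists (at_z0 h); rewrite leqNgt ds add0r at_z0_R2w.
have : exists h : Pz,
    at_z0 (foldr (@bessel_mod R m n) (Kt (size s)) s) =
    \prod_(k <- s) spvar C k + R2 R m n * h.
  have [h ->] := foldr_bessel_mod s (size s); exists (at_z0 h).
  rewrite leqnn subnn rep_kernel0 linearD /= at_z0_R2w.
  by rewrite at_z0_prod_w at_z0_1 mulr1.
case=> h0 e0.
pose F d := at_z0 (foldr (@bessel_mod R m n) (Kt d) s).
have [h1 e1] : exists h : Pz, \sum_(d < size s) F d = R2 R m n * h.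
  have : forall d, (d <= size s)%N ->
      exists h : Pz, \sum_(e < d) F e = R2 R m n * h.
    elim=> [|d IHd] ds; first by exists 0; rewrite big_ord0 mulr0.
    have [h e] := IHd (ltnW ds); have [h' e'] := at0 d ds.
    by exists (h + h'); rewrite big_ord_recr /= e /F e' mulrDr.
  by apply.
exists (h0 + h1); rewrite mulrDr addrA -e0 -e1 addrC.
(* Cut after d = [size s]: the tail vanishes exactly, and the last remaining term carries the
   monomial. *)
rewrite -(big_mkord xpredT F) (big_cat_nat (n := (size s).+1)) //=.
rewrite [X in _ + X]big_nat_cond [X in _ + X]big1 ?addr0; last first.
  by move=> d /andP[/andP[sd _] _]; exact: at_z0_foldr_gt.
by rewrite big_mkord big_ord_recr.
Qed.

Lemma bessel_fischer_kernelE (p : Pz) d : bessel_fischer p (Kt d) =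
  \sum_(D : {set 'I_(2 * n)}) \sum_(mu <- msupp (spcoef p D))
    (spcoef p D)@_mu
      *: at_z0 (foldr (@bessel_mod R m n) (Kt d) (factors mu D)).
Proof.
rewrite /bessel_fischer.
have -> : conj_sp (Kt d) = Kt d.
  have cE (c : R) : (real_complex R c)^*%C = real_complex R c.
    by rewrite /= oppr0.
  by rewrite rep_kernelE conj_spZ cE conj_sp_zwX.
rewrite linear_sum; apply: eq_bigr => D _.
by rewrite linear_sum; apply: eq_bigr => mu _; rewrite linearZ.
Qed.

Lemma sum_R2_multiple (J : Type) (s : seq J) (P : pred J) (F : J -> Pz) :
  (forall x, P x -> exists h : Pz, F x = R2 R m n * h) ->
  exists h : Pz, \sum_(x <- s | P x) F x = R2 R m n * h.
Proof.
move=> FE; elim/big_rec: _ => [|x f Px [h ->]].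
  by exists 0; rewrite mulr0.
by have [h' ->] := FE x Px; exists (h' + h); rewrite mulrDr.
Qed.

Lemma reproducing (p : Pz) : exists s : Pz,
  has_finsum (fun d => bessel_fischer p (Kt d)) s /\
  exists h : Pz, s - p = R2 R m n * h.
Proof.
(* One more than the largest number of factors of a monomial of [p]: from degree [N] on, every
   monomial gives 0. *)
pose N := (\max_(D : {set 'I_(2 * n)}) \max_(mu <- msupp (spcoef p D))
             size (factors mu D)).+1.
have sN D mu : mu \in msupp (spcoef p D) -> (size (factors mu D) < N)%N.
  move=> mup; rewrite ltnS.
  apply: leq_trans (leq_bigmax (F := fun D : {set 'I_(2 * n)} =>
    \max_(mu <- msupp (spcoef p D)) size (factors mu D)) D).
  exact: (leq_bigmax_seq (F := fun mu => size (factors mu D))).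
exists (\sum_(d < N) bessel_fischer p (Kt d)); split.
  exists N; split=> // d Nd; rewrite bessel_fischer_kernelE big1 // => D _.
  rewrite big_seq big1 // => mu mup.
  by rewrite at_z0_foldr_gt ?scaler0 // (leq_trans (sN _ _ mup)).
rewrite {2}[p]superpoly_expand.
under [X in X - _]eq_bigr do rewrite bessel_fischer_kernelE.
rewrite exchange_big -sumrB; apply: sum_R2_multiple => D _.
rewrite exchange_big -sumrB big_seq; apply: sum_R2_multiple => mu mup.
have [h e] := sum_at_z0_foldr (sN D mu mup); exists ((spcoef p D)@_mu *: h).
by rewrite /= -scaler_sumr -scalerBr e addrAC subrr add0r scalerAr.
Qed.

End Reproducing.

Theorem theorem4p11 (R : realType) (m n : nat) (hm : (2 <= m)%N)
  (hM : forall l : nat, superdim m n - 2 <> - (2 * l)%:Z) :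
  (forall k : nat,
     rep_kernel R m n k =
       real_complex R ((4 ^+ k * k`!%:R)^-1
                       * (poch (half_superdim R m n - 1) k)^-1) *: zw R m n ^+ k)
  /\ (forall (P : fock R m n) (p : superpoly R[i] m (2 * n)),
        P = \pi_(fock R m n) p ->
        exists s : superpoly R[i] m (2 * n),
          has_finsum (fun k => bessel_fischer p (rep_kernel R m n k)) s
          /\ \pi_(fock R m n) s = P).
Proof.
have m_gt0 : (0 < m)%N by exact: ltnW.
(* Twice this number is the integer M - 2 + 2l, so its vanishing would contradict the assumption on
   M. *)
have half_neq0 (l : nat) : half_superdim R m n - 1 + l%:R != 0.
  apply/eqP => e; apply: (hM l); apply/eqP.
  rewrite -subr_eq0 opprK -(intr_eq0 R) intrD PoszM intrM.
  have <- : 2 * (half_superdim R m n - 1 + l%:R)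
            = (superdim m n - 2)%:~R + 2%:~R * l%:~R.
    have e2 : (2 : int)%:~R = 2 :> R by [].
    by rewrite /half_superdim [(superdim m n - 2)%:~R]intrB e2; field.
  by rewrite e mulr0.
split=> [k|_ p ->]; first exact: rep_kernelE.
have [s [sE [h e]]] := reproducing m_gt0 half_neq0 p.
exists s; split=> //; apply/eqP; rewrite -Quotient.idealrBE e.
(* In the two-sided ideal, the multiple of R^2 by [h] is a single summand with left factor 1. *)
by apply/asboolP; exists [:: (1, h)]; rewrite big_seq1 mul1r.
Qed.
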